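(* Let $\alpha_i=O(\zeta)\in(0,1)$, $\beta_i=O(\zeta)\in(0,1)$ for $i=1,\dots,m-1$ and $\alpha_m=\beta_0=0$. Define $\overline{\alpha}_i=\max\{\alpha_j: i<j\le m\}$ and $\overline{\beta}_i=\max\{\beta_j:0\le j\le i\}$ for $i=0,1,\dots,m-1$. Suppose that $\varphi_n$ is a ULCE of $\theta$. Suppose that the maximum sample size $n_s$ is no less than the minimum integer $n$ such that $f(n,\theta_i'',\beta_i)\ge g(n,\theta_i',\alpha_i)$ for $i=1,\dots,m-1$. Define $f_{\ell,i}=\underline{f}(n_\ell,\theta_i',\theta_i'',\alpha_i,\beta_i)$ and $g_{\ell,i}=\overline{g}(n_\ell,\theta_i',\theta_i'',\alpha_i,\beta_i)$ for $i=1,\dots,m-1$, and for $\ell=1,\dots,s$ define the decision variable $$D_\ell=\begin{cases}1&\text{if }\hat\theta_\ell\le f_{\ell,1},\\ i&\text{if } g_{\ell,i-1}<\hat\theta_\ell\le f_{\ell,i}\text{ where }2\le i\le m-1,\\ m&\text{if }\hat\theta_\ell>g_{\ell,m-1},\\ 0&\text{else.}\end{cases}$$ Then the following statements (I)-(VI) hold true for $m\ge2$. (I) $\Pr\{\text{Reject }H_0\mid\theta\}$ is non-decreasing with respect to $\theta\in\varTheta_0$. (II) $\Pr\{\text{Reject }H_{m-1}\mid\theta\}$ is non-increasing with respect to $\theta\in\varTheta_{m-1}$. (III) $\Pr\{\text{Reject }H_i\mid\theta\}\le s(\overline{\alpha}_i+\overline{\beta}_i)$ for any $\theta\in\varTheta_i$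 and $i=0,1,\dots,m-1$. (IV) For $0<i\le m-1$, $\Pr\{\text{Accept }H_i\mid\theta\}$ is no greater than $s\alpha_i$ and is non-decreasing with respect to $\theta\in\Theta$ no greater than $\theta_i'$. (V) For $0\le i\le m-2$, $\Pr\{\text{Accept }H_i\mid\theta\}$ is no greater than $s\beta_{i+1}$ and is non-increasing with respect to $\theta\in\Theta$ no less than $\theta_{i+1}''$. (VI) Assume that $\mathbb{E}[e^{\rho X}]$ exists for any $\rho\in\mathbb{R}$ and that $\varphi_n=\frac1n\sum_{i=1}^nX_i$ is an unbiased and unimodal-likelihood estimator of $\theta$, where $X_1,X_2,\dots$ are i.i.d. samples of $X$. Then, for $i=0,1,\dots,m-1$, $\lim_{\zeta\to0}\Pr\{\text{Reject }H_i\mid\theta\}=0$ for any $\theta\in\varTheta_i$. Moreover, the following statements (VII), (VIII) and (IX) hold true for $m\ge3$. (VII) $$\Pr\{\text{Reject }H_i\mid\theta\}\le\Pr\{\text{Reject }H_i,\ \hat\theta\le a\mid a\}+\Pr\{\text{Reject }H_i,\ \hat\theta\ge b\mid b\},$$ $$\Pr\{\text{Reject }H_i\mid\theta\}\ge\Pr\{\text{Reject }H_i,\ \hat\theta\le a\mid b\}+\Pr\{\text{Reject }H_i,\ \hat\theta\ge b\mid a\}$$ for any $\theta\in[a,b]\subseteq\varTheta_i$ and $1\le i\le m-2$. (VIII) $\Pr\{\text{Reject }H_0\text{ and }H_{m-1}\mid\theta\}$ is non-decreasing with respect to $\theta\in\varTheta_0$ and is non-increasing with respect to $\theta\in\varTheta_{m-1}$.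 (IX) $\Pr\{\text{Reject }H_0\text{ and }H_{m-1}\mid\theta\}$ is no greater than $s\times\max\{\alpha_i:1\le i\le m-2\}$ for $\theta\in\varTheta_0$ and is no greater than $s\times\max\{\beta_i:2\le i\le m-1\}$ for $\theta\in\varTheta_{m-1}$.
   Context: Samples and hypotheses. $X_1,X_2,\dots$ are identical samples of a random variable $X$ parameterized by $\theta\in\Theta$ (a set of real parameter values); $\Pr\{\cdot\mid\theta\}$ is probability when the parameter is $\theta$. The hypotheses are $H_i:\theta\in\Theta_i$, $i=0,\dots,m-1$, with $\Theta_i=\{\theta\in\Theta:\theta_i<\theta\le\theta_{i+1}\}$, $-\infty=\theta_0<\theta_1<\dots<\theta_{m-1}<\theta_m=\infty$. Further $\theta_i',\theta_i''\in\Theta$ ($1\le i\le m-1$) satisfy $\theta_i'<\theta_i<\theta_i''$ and $\theta_i''\le\theta_{i+1}'$ (for $i\le m-2$), and $\varTheta_i=\{\theta\in\Theta_i:\theta_i''\le\theta\le\theta_{i+1}'\}$ for $0\le i\le m-1$, with $\theta_0''=-\infty$, $\theta_m'=\infty$. Estimators. An estimator $\varphi(X_1,\dots,X_r)$ is a unimodal-likelihood estimator (ULE) of $\theta$ if for every observation $(x_1,\dots,x_r)$ the likelihood function (joint pmf, or joint pdf, of $X_1,\dots,X_r$ at $(x_1,\dots,x_r)$) is non-decreasing with respect to $\theta$ no greater than $\varphi(x_1,\dots,x_r)$ and non-increasing with respect to $\theta$ no less than $\varphi(x_1,\dots,x_r)$ (the length $r$ may be deterministic or random). $\varphi_n=\varphi(X_1,\dots,X_n)$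 is a unimodal-likelihood consistent estimator (ULCE) of $\theta$ if it is a ULE of $\theta$ for every $n$ and converges in probability to $\theta$ as $n\to\infty$. Functions. $I_Z$ is the support (set of possible values) of $Z$; $F_Z(z,\theta)=\Pr\{Z\le z\mid\theta\}$, $G_Z(z,\theta)=\Pr\{Z\ge z\mid\theta\}$. For $n\in\mathbb{N}$, $\theta\in\Theta$, $\delta\in(0,1)$: $f(n,\theta,\delta)=\max\{z\in I_{\varphi_n}:F_{\varphi_n}(z,\theta)\le\delta,\ z\le\theta\}$ if this set is non-empty, and $-\infty$ otherwise; $g(n,\theta,\delta)=\min\{z\in I_{\varphi_n}:G_{\varphi_n}(z,\theta)\le\delta,\ z\ge\theta\}$ if this set is non-empty, and $\infty$ otherwise. For $\theta'<\theta''$ in $\Theta$ and $\delta',\delta''\in(0,1)$: $\underline f(n,\theta',\theta'',\delta',\delta'')=\min\{f(n,\theta'',\delta''),\tfrac12[f(n,\theta'',\delta'')+g(n,\theta',\delta')]\}$, $\overline g(n,\theta',\theta'',\delta',\delta'')=\max\{g(n,\theta',\delta'),\tfrac12[f(n,\theta'',\delta'')+g(n,\theta',\delta')]\}$. Multistage plan. There are $s$ stages with sample sizes $n_1<\dots<n_s$; $\hat\theta_\ell=\varphi_{n_\ell}$. Sampling continues until the first stage $\ell$ with $D_\ell\ne0$; call this stage $\boldsymbol l$, and put $\hat\theta=\hat\theta_{\boldsymbol l}$. Hypothesis $H_j$ is accepted if $D_{\boldsymbol l}=j+1$; ''Reject $H_i$'' means that some $H_j$ with $j\ne i$ is accepted.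 Only closed plans are considered, i.e. $\Pr\{D_s=0\}=0$. Dependence on $\zeta$. $\zeta>0$ is a risk tuning parameter; $\alpha_i,\beta_i$ are functions of $\zeta$, and $s$ and the sample sizes may depend on $\zeta$. The notation $\delta=O(\zeta)$ means: $\delta$ is a function of $\zeta>0$ such that there exist constants $A$ and $B$ with $A<\delta/\zeta<B$ provided that $\zeta>0$ is sufficiently small.
   Formalization: In the notation O(ζ) the lower constant A is required to be positive (otherwise (VI) fails), and the second inequality of (VII) is stated only for a<b (for a=b an atom of the estimator at a is counted twice and it can fail). *)

(* Defs.v *)
From HB Require Import structures.
From mathcomp Require Import all_boot all_order all_algebra.
From mathcomp Require Import all_classical all_reals all_analysis.

Set Implicit Arguments.
Unset Strict Implicit.
Unset Printing Implicit Defensive.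

Import Order.TTheory GRing.Theory Num.Theory.
Import numFieldNormedType.Exports.

Local Open Scope classical_set_scope.
Local Open Scope ring_scope.

(* Throughout, the parametric model is a family [P t] of probabilities on one
   sample space [T], of which only the members with [Theta t] are used;
   [Xs i] is the sample X_(i+1). *)

Section Samples.
Context (d : measure_display) (T : measurableType d) (R : realType).
Implicit Types (Theta : set R) (P : R -> probability T R).
Implicit Types (X : {mfun T >-> R}) (Xs : nat -> {mfun T >-> R}).

Definition observation Xs (n : nat) (w : T) : n.-tuple R :=
  [tuple Xs i w | i < n].

Definition identical_samples Theta P X Xs : Prop :=
  forall t, Theta t -> forall (i : nat) (A : set R), measurable A ->
    distribution (P t) (Xs i) A = distribution (P t) X A.

Definition mutually_independent (Q : probability T R) Xs : Prop :=
  forall (J : seq nat) (A : nat -> set R), uniq J ->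
    (forall i, measurable (A i)) ->
    Q [set w | forall i, i \in J -> A i (Xs i w)]
    = (\prod_(i <- J) Q (Xs i @^-1` A i))%E.

Definition joint_pmf Theta P Xs (n : nat) (L : R -> n.-tuple R -> R) : Prop :=
  forall t, Theta t ->
    (forall i, exists2 C : set R, countable C & P t (Xs i @^-1` C) = 1%E) /\
    forall x : n.-tuple R, (L t x)%:E = P t [set w | observation Xs n w = x].

(* This determines [mu], by sigma-finiteness. *)
Definition is_lebesgue_measure_tuple (n : nat)
    (mu : {measure set (n.-tuple R) -> \bar R}) : Prop :=
  forall A : 'I_n -> set R, (forall i, measurable (A i)) ->
    mu [set x : n.-tuple R | forall i, A i (tnth x i)]
    = (\prod_(i < n) lebesgue_measure (A i))%E.

(* [L t] is one version of the density, fixed everywhere: [ULE] below is a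
   pointwise requirement on it. *)
Definition joint_pdf Theta P Xs (n : nat) (L : R -> n.-tuple R -> R) : Prop :=
  exists2 mu : {measure set (n.-tuple R) -> \bar R},
    is_lebesgue_measure_tuple mu &
    forall t, Theta t ->
      [/\ forall x, 0 <= L t x, measurable_fun setT (L t) &
       forall B : set (n.-tuple R), measurable B ->
         P t (observation Xs n @^-1` B) = (\int[mu]_(x in B) (L t x)%:E)%E].

Definition likelihood Theta P Xs (L : forall n, R -> n.-tuple R -> R) : Prop :=
  (forall n, (0 < n)%N -> joint_pmf Theta P Xs (L n)) \/
  (forall n, (0 < n)%N -> joint_pdf Theta P Xs (L n)).

Definition ULE Theta Xs (L : forall n, R -> n.-tuple R -> R) (n : nat)
    (phi : n.-tuple R -> R) : Prop :=
  forall w : T, let x := observation Xs n w in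
    (forall t1 t2, Theta t1 -> Theta t2 -> t1 <= t2 -> t2 <= phi x ->
       L n t1 x <= L n t2 x) /\
    (forall t1 t2, Theta t1 -> Theta t2 -> phi x <= t1 -> t1 <= t2 ->
       L n t2 x <= L n t1 x).

Definition ULCE Theta P Xs (L : forall n, R -> n.-tuple R -> R)
    (phi : forall n, n.-tuple R -> R) : Prop :=
  (forall n, (0 < n)%N -> ULE Theta Xs L (phi n)) /\
  forall t, Theta t -> forall e, 0 < e ->
    P t [set w | e <= `|phi n (observation Xs n w) - t|] @[n --> \oo] --> 0%E.

End Samples.

Section Quantiles.
Context (d : measure_display) (T : measurableType d) (R : realType).
Variables (Theta : set R) (P : R -> probability T R).
Implicit Types (Z : T -> R) (t a b : R).

(* The topological support of the law of [Z], over all parameter values. *)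
Definition possible_values Z : set R :=
  [set z | exists2 t, Theta t &
     forall e, 0 < e -> (0 < P t [set w | (`|Z w - z| < e)%R])%E].

Definition F_ Z z t : \bar R := P t [set w | Z w <= z].
Definition G_ Z z t : \bar R := P t [set w | z <= Z w].

Definition lower_set Z t a : set R :=
  [set z | [/\ possible_values Z z, (F_ Z z t <= a%:E)%E & z <= t]].
Definition upper_set Z t a : set R :=
  [set z | [/\ possible_values Z z, (G_ Z z t <= a%:E)%E & t <= z]].

(* These are a maximum and a minimum when [extrema_attained] holds
   (see [f_maxE] and [g_minE]), and -oo and +oo on an empty set. *)
Definition f_ Z t a : \bar R := ereal_sup (EFin @` lower_set Z t a).
Definition g_ Z t a : \bar R := ereal_inf (EFin @` upper_set Z t a).

Lemma f_maxE Z t a z : lower_set Z t a z -> ubound (lower_set Z t a) z ->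
  f_ Z t a = z%:E.
Proof.
move=> Sz ub; apply/eqP; rewrite eq_le; apply/andP; split.
  by apply: ge_ereal_sup => _ [y Sy <-]; rewrite lee_fin; exact: ub.
by apply: ereal_sup_ubound; exists z.
Qed.

Lemma g_minE Z t a z : upper_set Z t a z -> lbound (upper_set Z t a) z ->
  g_ Z t a = z%:E.
Proof.
move=> Sz lb; apply/eqP; rewrite eq_le; apply/andP; split.
  by apply: ereal_inf_lbound; exists z.
by apply: le_ereal_inf_tmp => _ [y Sy <-]; rewrite lee_fin; exact: lb.
Qed.

Definition extrema_attained Z : Prop :=
  forall t a, Theta t -> 0 < a < 1 ->
    (lower_set Z t a !=set0 ->
       exists2 z, lower_set Z t a z & ubound (lower_set Z t a) z) /\
    (upper_set Z t a !=set0 ->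
       exists2 z, upper_set Z t a z & lbound (upper_set Z t a) z).

(* -oo + +oo = -oo here, but in that case neither the min nor the max below
   depends on the value given to the sum. *)
Definition midpoint Z t1 t2 a b : \bar R :=
  (2^-1%:E * (f_ Z t2 b + g_ Z t1 a))%E.
Definition f_under Z t1 t2 a b : \bar R :=
  Order.min (f_ Z t2 b) (midpoint Z t1 t2 a b).
Definition g_over Z t1 t2 a b : \bar R :=
  Order.max (g_ Z t1 a) (midpoint Z t1 t2 a b).

End Quantiles.

Section Plan.
Context (d : measure_display) (T : measurableType d) (R : realType).

Definition parameter_set (Theta : set R) (th : nat -> \bar R) (i : nat) :
    set R :=
  [set t | Theta t /\ (th i < t%:E <= th i.+1)%E].

(* The part of [parameter_set] outside the indifference zones; the bound is
   -oo on the left of the first set and +oo on the right of the last one. *)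
Definition reduced_set (m : nat) (Theta : set R) (th : nat -> \bar R)
    (th' th'' : nat -> R) (i : nat) : set R :=
  [set t | [/\ parameter_set Theta th i t,
     ((if i == 0%N then -oo else (th'' i)%:E) <= t%:E)%E &
     (t%:E <= (if i.+1 == m then +oo else (th' i.+1)%:E))%E]].

(* The cases are exclusive when f i <= g i and f i <= g j for i < j. *)
Definition decision (m : nat) (f g : nat -> \bar R) (x : R) : nat :=
  if (x%:E <= f 1%N)%E then 1%N
  else if [pick i : 'I_m | (2 <= i)%N && (g i.-1 < x%:E <= f i)%E] is Some i
  then nat_of_ord i
  else if (g m.-1 < x%:E)%E then m
  else 0%N.

(* The first of the stages 1, .., s with a nonzero decision, and [s] if there
   is none; in the latter case no hypothesis is accepted. *)
Definition stopping_stage (s : nat) (D : nat -> T -> nat) (w : T) : nat :=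
  head s [seq l <- iota 1 s | D l w != 0%N].

Definition accept (s : nat) (D : nat -> T -> nat) (j : nat) : set T :=
  [set w | D (stopping_stage s D w) w = j.+1].

Definition reject (m s : nat) (D : nat -> T -> nat) (i : nat) : set T :=
  [set w | exists j, [/\ (j < m)%N, j <> i & accept s D j w]].

(* The lower constant is positive: all the functions below are positive, so
   that with A <= 0 the first inequality would say nothing. *)
Definition order_zeta (delta : R -> R) : Prop :=
  exists A B, 0 < A /\ \forall z \near 0^'+, A < delta z / z < B.

End Plan.

(* Main.v *)
(* An accept or reject event is the disjoint union over the stages
   l of the event that sampling stops at l with the prescribed decision. Such a
   piece is determined by the first n_l samples, and on it the estimate lies on
   a known side of the parameter values to be compared. There the ULE property
   orders the likelihoods pointwise, hence the probabilities; this gives the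
   monotonicity statements and (VII). For (III) and (IX), the half-lines that
   occur at one stage are nested, so that their union is one of them and has
   probability at most a single alpha_j or beta_j.

   In (VI) the number of stages may grow arbitrarily fast as zeta tends to 0,
   so that (III) is not enough. A one-sided error at a stage with n samples is
   O(zeta), but it is also at most M q^n with q < 1, uniformly in zeta. Indeed
   let K < 1 be a Chernoff rate for the deviations of the mean from theta'. If
   K^n <= alpha, a possible value y of the mean strictly between theta' and
   theta'' satisfies g <= y, the midpoint (f + g) / 2 stays away from theta'',
   and Chernoff's bound at theta'' applies; otherwise zeta = O(K^n), and the
   O(zeta) bound is itself geometric. Since the sample sizes are distinct, the
   errors of all stages sum to at most N O(zeta) + O(q^N), for every N. *)
Require Import Defs.
From HB Require Import structures.
From mathcomp Require Import all_boot all_order all_algebra.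
From mathcomp Require Import all_classical all_reals all_analysis.
From mathcomp Require Import measurable_realfun lra ring.

Set Implicit Arguments.
Unset Strict Implicit.
Unset Printing Implicit Defensive.

Import Order.TTheory GRing.Theory Num.Theory.
Import numFieldNormedType.Exports.

Local Open Scope classical_set_scope.
Local Open Scope ring_scope.

(** Two obstacles shape the work for (VI). Independence is given for events only, whereas Chernoff's
    bound needs the expectation of a product; the factorisation is transferred from indicators to a
    general nonnegative function one sample at a time. The other obstacle is the possible value y of
    the mean that pulls the midpoint (f + g) / 2 away from theta'': for a discrete law there may be
    none in a given interval. It is built from two support points p < theta < q of X, theta being
    the true mean: averages of k values near q and n - k values near p form a grid of mesh (q - p) /
    n, which meets any interval between p and q once n is large. Such p and q exist unless X is
    almost surely equal to theta, and in that degenerate case the one-sided errors at theta are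
    null. Finally y is a support point under one parameter, while its tail probability is bounded
    under the other. The two can be combined because [possible_values] collects support points over
    all parameters. *)

Section measurable_order.
Context d (T : measurableType d) (R : realType).
Implicit Types f g : T -> R.

Lemma measurable_lt_set f g : measurable_fun setT f -> measurable_fun setT g ->
  measurable [set w | f w < g w].
Proof.
move=> mf mg; rewrite -[X in measurable X]setTI.
exact: (measurable_fun_ltr mf mg measurableT (Y := [set true])).
Qed.

Lemma measurable_le_set f g : measurable_fun setT f -> measurable_fun setT g ->
  measurable [set w | f w <= g w].
Proof.
move=> mf mg; rewrite -[X in measurable X]setTI.
exact: (measurable_fun_ler mf mg measurableT (Y := [set true])).
Qed.

End measurable_order.

(** * Expectations of products of independent samples *)

Section independence.
Context d (T : measurableType d) (R : realType) (Q : probability T R).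
Import HBNNSimple.

(** The hypothesis on indicators says that [W] factors out of events on [V], with [c] as its
    expectation. It extends to [g] by linearity on simple functions and then by monotone convergence
    on both sides. *)
Lemma integral_mul_comp (W V : T -> R) (c : R) (g : R -> R) :
  measurable_fun setT W -> (forall w, 0 <= W w) -> measurable_fun setT V ->
  (forall A, measurable A ->
     (\int[Q]_w (W w * \1_A (V w))%:E = c%:E * Q (V @^-1` A))%E) ->
  measurable_fun setT g -> (forall x, 0 <= g x) ->
  (\int[Q]_w (W w * g (V w))%:E = c%:E * \int[Q]_w (g (V w))%:E)%E.
Proof.
move=> mW W0 mV WV mg g0.
have c0 : 0 <= c.
  rewrite -lee_fin -[leRHS]mule1 -(probability_setT Q) -(preimage_setT V) -WV//.
  apply: integral_ge0 => w _.
  by rewrite lee_fin mulr_ge0// indicE.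
move/measurable_EFinP: (mg) => mEg.
pose gn := nnsfun_approx measurableT mEg.
have gn_ge0 n x : 0 <= gn n x by [].
have mgV n : measurable_fun setT (gn n \o V).
  by apply: measurableT_comp => //; exact: measurable_funP.
have gncvg x : EFin \o gn ^~ x @ \oo --> (g x)%:E.
  by apply: cvg_nnsfun_approx => // y _; rewrite lee_fin.
have step n : (\int[Q]_w (W w * gn n (V w))%:E
               = c%:E * \int[Q]_w (gn n (V w))%:E)%E.
  pose r : seq R := finmap.enum_fset (fset_set (range (gn n))).
  (* The values of [gn n] are nonnegative, so [|y|] is [y] on its range; written this way every
     summand is nonnegative without a membership condition, as [ge0_integral_sum] requires. *)
  have gnE (x : R) : gn n x = \sum_(y <- r) `|y| * \1_(gn n @^-1` [set y]) x :>
    R.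
    rewrite {1}fimfunE fsbig_finite//= -/r big_seq [RHS]big_seq.
    apply: eq_bigr => y; rewrite in_fset_set// inE => -[z _ <-].
    by rewrite (ger0_norm (gn_ge0 n z)).
  have mA (y : R) : measurable (gn n @^-1` [set y]) by exact: measurable_funPTI.
  have mI y : measurable_fun setT (fun w => \1_(gn n @^-1` [set y]) (V w) : R).
    apply: (@measurableT_comp _ _ _ _ _ _ (\1_(gn n @^-1` [set y]) : R -> R)) =>
      //.
  have V1 y : (\int[Q]_w (\1_(gn n @^-1` [set y]) (V w))%:E
      = Q (V @^-1` (gn n @^-1` [set y])))%E.
    have mP : measurable (V @^-1` (gn n @^-1` [set y])).
      by rewrite -[X in measurable X]setTI; exact: mV.
    by have := integral_indic Q measurableT mP; rewrite setIT => <-.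
  transitivity (\sum_(y <- r) (`|y|%:E * (c%:E * Q (V @^-1` (gn n @^-1` [set
    y])))))%E.
    under eq_integral => w _ do rewrite gnE mulr_sumr -sumEFin.
    rewrite ge0_integral_sum//.
    - apply: eq_bigr => y _; rewrite -WV// -ge0_integralZl//.
      + by apply: eq_integral => w _; rewrite -EFinM; congr EFin; ring.
      + by apply/measurable_EFinP; exact: measurable_funM.
      + by move=> w _; rewrite lee_fin mulr_ge0// indicE.
    - move=> y; apply/measurable_EFinP; apply: measurable_funM => //.
      exact: measurable_funM.
    - by move=> y w _; rewrite lee_fin !mulr_ge0// indicE.
  transitivity (c%:E * \sum_(y <- r) (`|y|%:E * Q (V @^-1` (gn n @^-1` [set
    y]))))%E.
    rewrite ge0_sume_distrr; first by apply: eq_bigr => y _; rewrite muleCA.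
    by move=> y _; rewrite mule_ge0.
  congr (_ * _)%E; under [RHS]eq_integral => w _ do rewrite gnE -sumEFin.
  rewrite ge0_integral_sum//.
  - apply: eq_bigr => y _; rewrite -V1 -ge0_integralZl//;
    exact/measurable_EFinP.
  - by move=> y; apply/measurable_EFinP; exact: measurable_funM.
have gnd x m n : (m <= n)%N -> gn m x <= gn n x.
  by move=> mn; exact/lefP/nd_nnsfun_approx.
have lim1 : (\int[Q]_w (W w * gn n (V w))%:E @[n --> \oo]
             --> \int[Q]_w (W w * g (V w))%:E)%E.
  rewrite [X in _ --> X](_ : _ = \int[Q]_w limn (fun n =>
    (W w * gn n (V w))%:E))%E.
    apply: cvg_monotone_convergence => //.
    - by move=> n; apply/measurable_EFinP; exact: (measurable_funM mW (mgV n)).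
    - by move=> n w _; rewrite lee_fin mulr_ge0.
    - by move=> w _ m n mn; rewrite lee_fin ler_wpM2l// gnd.
  apply: eq_integral => w _; apply/esym/cvg_lim => //.
  rewrite (EFinM (W w)); under eq_fun do rewrite EFinM.
  by apply: cvgeZl => //; exact: gncvg.
have lim2 : (c%:E * \int[Q]_w (gn n (V w))%:E @[n --> \oo]
             --> c%:E * \int[Q]_w (g (V w))%:E)%E.
  apply: cvgeZl => //.
  rewrite [X in _ --> X](_ : _ = \int[Q]_w limn (fun n => (gn n (V w))%:E))%E.
    apply: cvg_monotone_convergence => //.
    - by move=> n; apply/measurable_EFinP; exact: mgV.
    - by move=> n w _; rewrite lee_fin.
    - by move=> w _ m n mn; rewrite lee_fin gnd.
  by apply: eq_integral => w _; apply/esym/cvg_lim => //; exact: gncvg.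
move: lim1; under eq_fun do rewrite step; move=> lim1.
exact: (cvg_unique _ lim1 lim2).
Qed.

End independence.

Section iid_samples.
Context d (T : measurableType d) (R : realType) (Q : probability T R).
Variables (X : {mfun T >-> R}) (Xs : nat -> {mfun T >-> R}).
Hypothesis indep : mutually_independent Q Xs.
Hypothesis same_law : forall (i : nat) (A : set R), measurable A ->
  distribution Q (Xs i) A = distribution Q X A.

Lemma ge0_integral_same_law (g : R -> R) (i : nat) :
  measurable_fun setT g -> (forall x, 0 <= g x) ->
  (\int[Q]_w (g (Xs i w))%:E = \int[Q]_w (g (X w))%:E)%E.
Proof.
move=> mg g0; move/measurable_EFinP: (mg) => mEg.
have h0 (y : R) : (0 <= (EFin \o g) y)%E by rewrite /= lee_fin.
have := @ge0_integral_distribution _ _ _ _ _ Q (Xs i) _ mEg h0.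
have := @ge0_integral_distribution _ _ _ _ _ Q X _ mEg h0.
rewrite /comp => <- <-.
by apply: eq_measure_integral => A mA _; exact: same_law.
Qed.

(** The mixed form makes the induction work: samples in [s] already carry [g], those in [r] still
    carry indicators. With [s] empty this is the definition of independence; the inductive step
    moves one sample from [r] to [s] by [integral_mul_comp]. *)
Lemma integral_prod_indep (g : R -> R) (c : R) (A : nat -> set R)
    (s r : seq nat) :
  measurable_fun setT g -> (forall x, 0 <= g x) ->
  (\int[Q]_w (g (X w))%:E = c%:E)%E ->
  (forall i, measurable (A i)) -> uniq (s ++ r) ->
  (\int[Q]_w (\prod_(i <- s) g (Xs i w) * \prod_(i <- r) \1_(A i) (Xs i w))%:E
   = (\prod_(i <- s) c)%:E * \prod_(i <- r) Q (Xs i @^-1` A i))%E.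
Proof.
move=> mg g0 gc.
have mgX i : measurable_fun setT (fun w => g (Xs i w)).
  by apply: (@measurableT_comp _ _ _ _ _ _ g).
elim: s r A => [|i s IH] r A mA us.
  rewrite big_nil mul1e -indep//.
  have mJ : measurable [set w | forall i, i \in r -> A i (Xs i w)].
    rewrite [X in measurable X](_ : _ =
      \bigcap_(i in [set i | i \in r]) (Xs i @^-1` A i)).
      by apply: fin_bigcap_measurable => [|i _];
        [exact: finite_seq|exact: measurable_funPTI].
    by apply/seteqP; split => w /= h i /h.
  rewrite -[in RHS](setIT [set w | _]) -integral_indic//.
  apply: eq_integral => w _; congr EFin; rewrite big_nil mul1r.
  rewrite indicE; have [/set_mem wJ|/negP wJ] := boolP (w \in _).
    by rewrite big_seq big1// => j jr; rewrite indicE mem_set//; exact: wJ.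
  have [j [jr Aj]] : exists j, j \in r /\ ~ A j (Xs j w).
    apply: contrapT => nj; apply: wJ; apply/mem_set => j jr.
    by apply: contrapT => Aj; apply: nj; exists j.
  apply/eqP; rewrite prodf_seq_eq0; apply/hasP; exists j => //=.
  by rewrite indicE memNset.
have usr : uniq (s ++ i :: r).
  by rewrite -cat1s uniq_catCA cat1s.
have ir : i \notin r by move: usr; rewrite cat_uniq => /and3P[_ _ /andP[]].
pose q := \prod_(j <- r) fine (Q (Xs j @^-1` A j)).
have qE : (\prod_(j <- r) Q (Xs j @^-1` A j) = q%:E)%E.
  rewrite /q -prodEFin; apply: eq_bigr => j _.
  by rewrite fineK// fin_num_measure//; exact: measurable_funPTI.
pose W w := \prod_(j <- s) g (Xs j w) * \prod_(j <- r) \1_(A j) (Xs j w).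
have mW : measurable_fun setT W.
  apply: measurable_funM; apply: measurable_prod => j _ //.
  by apply: (@measurableT_comp _ _ _ _ _ _ (\1_(A j) : R -> R)) => //.
have W0 w : 0 <= W w.
  by apply: mulr_ge0; apply: prodr_ge0 => j _ //; rewrite indicE.
have WX B : measurable B -> (\int[Q]_w (W w * \1_B (Xs i w))%:E
    = (\prod_(j <- s) c * q)%:E * Q (Xs i @^-1` B))%E.
  (* Since [i] does not occur in [r], its set can be replaced by an arbitrary [B] without affecting
     the other factors. *)
  move=> mB; pose A' j := if j == i then B else A j.
  have mA' j : measurable (A' j) by rewrite /A'; case: ifP.
  have A'i : A' i = B by rewrite /A' eqxx.
  have A'r j : j \in r -> A' j = A j.
    by move=> jr; rewrite /A'; case: eqP jr ir => // -> ->.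
  have := IH (i :: r) A' mA' usr.
  rewrite big_cons (eq_big_seq (fun j => Q (Xs j @^-1` A j))); last first.
    by move=> j /A'r ->.
  rewrite qE A'i EFinM -muleA (muleC q%:E) => <-.
  apply: eq_integral => w _; rewrite /W big_cons A'i.
  rewrite [in RHS](@eq_big_seq _ _ _ _ r _ (fun j => \1_(A j) (Xs j w)));
    last by move=> j /A'r ->.
  by congr EFin; ring.
rewrite big_cons qE -EFinM -mulrA mulrC EFinM -gc -(ge0_integral_same_law i)//.
rewrite -(integral_mul_comp mW W0 _ WX)//.
by apply: eq_integral => w _; rewrite /W big_cons; congr EFin; ring.
Qed.

Lemma integral_prod_iid (g : R -> R) (c : R) (n : nat) :
  measurable_fun setT g -> (forall x, 0 <= g x) ->
  (\int[Q]_w (g (X w))%:E = c%:E)%E ->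
  (\int[Q]_w (\prod_(i < n) g (Xs i w))%:E = (c ^+ n)%:E)%E.
Proof.
move=> mg g0 gc.
have := @integral_prod_indep g c (fun=> setT) (iota 0 n) [::] mg g0 gc.
move=> /(_ (fun=> measurableT)); rewrite cats0 iota_uniq => /(_ isT).
rewrite big_nil mule1 -{2}[n in iota 0 n]subn0 big_const_nat subn0 iter_mulr_1.
move=> <-; apply: eq_integral => w _.
by rewrite big_nil mulr1 -(big_mkord xpredT (fun i =>
  g (Xs i w))) /index_iota subn0.
Qed.

End iid_samples.

(** * Exponential bounds for the sample mean *)

Section chernoff.
Context d (T : measurableType d) (R : realType) (Q : probability T R).

(** A Taylor bound whose remainder is r^2 times a function of [y] alone, integrable when the
    exponential moments exist. It replaces differentiation of the moment generating function at
    0. *)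
Lemma expR_le_quadratic (r y : R) : 0 <= r <= 1 ->
  expR (r * y) <= 1 + r * y + r ^+ 2 * (4 * (expR (2 * y) + expR (- 2 * y))).
Proof.
move=> /andP[r0 r1].
set u := r * y.
have h1 : expR u <= 1 + u + u * (expR u - 1).
  have : (1 - u) * expR u <= 1.
    have := expR_ge1Dx (- u); rewrite expRN => h.
    by rewrite -[leRHS](mulVf (lt0r_neq0 (expR_gt0 u))) ler_wpM2r ?expR_ge0.
  by nra.
have h2 : u * (expR u - 1) <= u ^+ 2 * expR `|u|.
  have [u0|u0] := leP 0 u.
    rewrite ger0_norm// expr2 -mulrA ler_wpM2l//.
    have := expR_ge1Dx (- u); rewrite expRN => h.
    have e0 := expR_gt0 u.
    have : (1 - u) * expR u <= 1.
      by rewrite -[leRHS](mulVf (lt0r_neq0 e0)) ler_wpM2r ?expR_ge0.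
    by nra.
  rewrite ltr0_norm//.
  have h3 := expR_ge1Dx u.
  have h4 : 1 <= expR (- u) by have := expR_ge1Dx (- u); lra.
  have : u * (expR u - 1) <= u * u by rewrite ler_wnM2l//; lra.
  by nra.
have h3 : u ^+ 2 * expR `|u| <= r ^+ 2 * (y ^+ 2 * expR `|y|).
  rewrite /u exprMn -mulrA; apply: ler_wpM2l; first exact: sqr_ge0.
  apply: ler_wpM2l; first exact: sqr_ge0.
  by rewrite ler_expR normrM (ger0_norm r0) ler_piMl.
(* Square of |y| / 2 <= 1 + |y| / 2 <= e^(|y| / 2); this is where the constant 4 originates. *)
have h4 : y ^+ 2 <= 4 * expR `|y|.
  have := expR_ge1Dx (`|y| / 2).
  have -> : expR `|y| = expR (`|y| / 2) ^+ 2.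
    by rewrite -expRM_natl; congr expR; field.
  have y0 := normr_ge0 y; rewrite -real_normK ?num_real//.
  by nra.
have h5 : expR `|y| * expR `|y| <= expR (2 * y) + expR (- 2 * y).
  rewrite -expRD.
  have := expR_ge0 (2 * y); have := expR_ge0 (- 2 * y).
  have [y0|y0] := leP 0 y.
    by rewrite ger0_norm// (_ : y + y = 2 * y); [lra|ring].
  by rewrite ltr0_norm// (_ : - y - y = - 2 * y); [lra|ring].
have h6 : y ^+ 2 * expR `|y| <= 4 * (expR (2 * y) + expR (- 2 * y)).
  have := expR_gt0 `|y|; nra.
have : r ^+ 2 * (y ^+ 2 * expR `|y|) <=
  r ^+ 2 * (4 * (expR (2 * y) + expR (- 2 * y))).
  by apply: ler_wpM2l => //; exact: sqr_ge0.
by lra.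
Qed.

(** Domination: |y| <= e^y + e^(-y). *)
Lemma integrable_of_expR (Y : T -> R) : measurable_fun setT Y ->
  Q.-integrable setT (fun w => (expR (Y w))%:E) ->
  Q.-integrable setT (fun w => (expR (- Y w))%:E) ->
  Q.-integrable setT (fun w => (Y w)%:E).
Proof.
move=> mY i1 i2.
apply: (le_integrable measurableT _ _ (integrableD measurableT i1 i2)).
  exact/measurable_EFinP.
move=> w _ /=; rewrite lee_fin.
rewrite [leRHS]ger0_norm ?addr_ge0 ?expR_ge0//.
have := expR_ge0 (Y w); have := expR_ge0 (- Y w).
have := expR_ge1Dx (Y w); have := expR_ge1Dx (- Y w).
by have [y0|y0] := leP 0 (Y w); rewrite ?(ger0_norm y0) ?(ltr0_norm y0); lra.
Qed.

(** By the quadratic bound the expectation of e^(rY) is at most 1 - c r + M r^2, and the negative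
    drift wins for small r. *)
Lemma mgf_lt1 (Y : T -> R) (c : R) : measurable_fun setT Y -> 0 < c ->
  (forall r, Q.-integrable setT (fun w => (expR (r * Y w))%:E)) ->
  (\int[Q]_w (Y w)%:E = (- c)%:E)%E ->
  exists r K, [/\ 0 < r, 0 <= K < 1 & (\int[Q]_w (expR (r * Y w))%:E = K%:E)%E].
Proof.
move=> mY c0 iY EY.
have i2 : Q.-integrable setT (fun w =>
  (4 * (expR (2 * Y w) + expR (-2 * Y w)))%:E).
  rewrite (_ : (fun w => _) = (fun w =>
    4%:E * ((expR (2 * Y w))%:E + (expR (-2 * Y w))%:E))%E)//.
  by apply: integrableZl => //; apply: integrableD.
have i1 : Q.-integrable setT (fun w => (Y w)%:E).
  apply: integrable_of_expR => //.
    by have := iY 1; under eq_fun do rewrite mul1r.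
  by have := iY (-1); under eq_fun do rewrite mulN1r.
set M := fine (\int[Q]_w (4 * (expR (2 * Y w) + expR (-2 * Y w)))%:E)%E.
have ME : (\int[Q]_w (4 * (expR (2 * Y w) + expR (-2 * Y w)))%:E = M%:E)%E.
  by rewrite fineK//; exact: integrable_fin_num.
have M0 : 0 <= M.
  rewrite -lee_fin -ME; apply: integral_ge0 => w _.
  by rewrite lee_fin mulr_ge0// addr_ge0// expR_ge0.
(* Chosen so that M r^2 <= c r / 2; [M + 1] keeps the denominator positive when [M] is 0. *)
pose r := Num.min 1 (c / (2 * (M + 1))).
have r0 : 0 < r by rewrite lt_min ltr01 divr_gt0// mulr_gt0//; lra.
have r1 : r <= 1 by rewrite ge_min lexx.
have rM : r * (2 * (M + 1)) <= c.
  by rewrite -ler_pdivlMr ?ge_min ?lexx ?orbT// mulr_gt0//; lra.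
have ri := iY r.
exists r, (fine (\int[Q]_w (expR (r * Y w))%:E)%E); split => //; last first.
  by rewrite fineK//; exact: integrable_fin_num.
apply/andP; split.
  by apply: fine_ge0; apply: integral_ge0 => w _; rewrite lee_fin expR_ge0.
rewrite -lte_fin fineK; last exact: integrable_fin_num.
have ic : Q.-integrable setT (fun=> 1%:E : \bar R).
  exact: finite_measure_integrable_cst.
have irY : Q.-integrable setT (fun w => r%:E * (Y w)%:E)%E by exact:
  integrableZl.
have i3 : Q.-integrable setT
    (fun w => (r ^+ 2)%:E * (4 * (expR (2 * Y w) + expR (-2 * Y w)))%:E)%E.
  exact: integrableZl.
apply: (@le_lt_trans _ _ (\int[Q]_w (1%:E + r%:E * (Y w)%:E +
    (r ^+ 2)%:E * (4 * (expR (2 * Y w) + expR (-2 * Y w)))%:E))%E).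
  apply: le_integral => //.
    by apply: integrableD => //; exact: integrableD.
  move=> w _; rewrite -!EFinM -!EFinD lee_fin.
  by apply: expR_le_quadratic; rewrite r1 ltW.
rewrite integralD//; last exact: integrableD.
have E1 : (\int[Q]_w (1%:E : \bar R) = 1)%E.
  by rewrite integral_cst// mul1e; exact: probability_setT.
rewrite integralD// !integralZl// E1 EY ME.
rewrite -!EFinM -!EFinD lte_fin.
by nra.
Qed.

End chernoff.

Section large_deviations.
Context d (T : measurableType d) (R : realType) (Q : probability T R).
Variables (X : {mfun T >-> R}) (Xs : nat -> {mfun T >-> R}).
Hypothesis indep : mutually_independent Q Xs.
Hypothesis same_law : forall (i : nat) (A : set R), measurable A ->
  distribution Q (Xs i) A = distribution Q X A.
Hypothesis mgf : forall r,
  Q.-integrable setT (fun w => (expR (r * X w))%:E).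
Variable t : R.
Hypothesis mean : (\int[Q]_w (X w)%:E = t%:E)%E.

Lemma integrable_mgf : Q.-integrable setT (fun w => (X w)%:E).
Proof.
apply: integrable_of_expR => //.
  by have := mgf 1; under eq_fun do rewrite mul1r.
by have := mgf (-1); under eq_fun do rewrite mulN1r.
Qed.

(** The function [y] has mean -c under X, so [mgf_lt1] applies to it. On the event the y(X_i) have a
    nonnegative sum, so the product of the e^(r y(X_i)) is at least 1 there, and Markov's inequality
    gives K^n. The values 1 and -1 of [sg] give the two tails. *)
Lemma chernoff_mean (sg c : R) : 0 < c -> exists2 K, 0 <= K < 1 &
  forall n, (0 < n)%N ->
  (Q [set w | (c <= sg * (n%:R^-1 * (\sum_(i < n) Xs i w) - t))%R]
   <= (K ^+ n)%:E)%E.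
Proof.
move=> c0.
pose y (x : R) := sg * (x - t) - c.
have my : measurable_fun setT y.
  apply: measurable_funB => //; apply: measurable_funM => //.
  exact: measurable_funB.
have myX : measurable_fun setT (y \o X) by exact: measurableT_comp.
have iy r : Q.-integrable setT (fun w => (expR (r * (y \o X) w))%:E).
  rewrite (_ : (fun w => _) = (fun w => (expR (- (r * (sg * t + c))))%:E *
     (expR (r * sg * X w))%:E)%E); first exact: integrableZl.
  apply/funext => w; rewrite -EFinM -expRD; congr (expR _)%:E.
  by rewrite /y /=; ring.
have Ey : (\int[Q]_w ((y \o X) w)%:E = (- c)%:E)%E.
  transitivity (\int[Q]_w (sg%:E * (X w)%:E + (- (sg * t) - c)%:E))%E.
    by apply: eq_integral => w _; rewrite -EFinM -EFinD; congr EFin;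
      rewrite /y /=; ring.
  have ic : Q.-integrable setT (fun=> (- (sg * t) - c)%:E : \bar R).
    exact: finite_measure_integrable_cst.
  have iX := integrable_mgf.
  have E1 : (\int[Q]_w ((- (sg * t) - c)%:E : \bar R) = (- (sg * t) - c)%:E)%E.
    by rewrite integral_cst// -[RHS]mule1; congr (_ * _)%E; exact:
      probability_setT.
  rewrite integralD//; last exact: integrableZl.
  by rewrite integralZl// E1 mean -EFinM -EFinD; congr EFin; ring.
have [r [K [r0 K01 EK]]] := mgf_lt1 myX c0 iy Ey.
exists K => // n n0.
pose g (x : R) := expR (r * y x).
have mg : measurable_fun setT g.
  by apply: measurableT_comp => //; exact: measurable_funM.
have g0 x : 0 <= g x by exact: expR_ge0.
rewrite -(integral_prod_iid indep same_law n mg g0 EK).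
have mS : measurable_fun setT (fun w =>
  sg * (n%:R^-1 * (\sum_(i < n) Xs i w) - t)).
  apply: measurable_funM => //; apply: measurable_funB => //.
  by apply: measurable_funM => //; exact: measurable_sum.
set A := [set w | _].
have mA : measurable A.
  exact: measurable_le_set.
rewrite -(setIT A) -integral_indic//.
apply: ge0_le_integral => //.
- exact/measurable_EFinP.
- apply/measurable_EFinP; apply: measurable_prod => i _.
  exact: (@measurableT_comp _ _ _ _ _ _ g).
move=> w _; rewrite lee_fin indicE; have [/set_mem /= Aw|] := boolP (w \in A);
  last first.
  by move=> _; exact: prodr_ge0.
rewrite /g -expR_sum -[leLHS]expR0 ler_expR -mulr_sumr mulr_ge0 ?(ltW r0)//.
rewrite /y sumrB -mulr_sumr sumrB !sumr_const card_ord.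
have nr0 : 0 < n%:R :> R by rewrite ltr0n.
rewrite [leRHS](_ : _ = n%:R * (sg * (n%:R^-1 * \sum_(i < n) Xs i w - t) - c)).
  by rewrite mulr_ge0 ?(ltW nr0)// subr_ge0.
rewrite -[t *+ n]mulr_natl -[c *+ n]mulr_natl; field.
exact: lt0r_neq0.
Qed.

End large_deviations.

(** * Possible values of the sample mean *)

Section support.
Context d (T : measurableType d) (R : realType) (Q : probability T R).

Definition support_point (Z : T -> R) (z : R) : Prop :=
  forall e, 0 < e -> (0 < Q [set w | (`|Z w - z| < e)%R])%E.

Lemma le_prob (A B : set T) : measurable A -> measurable B -> A `<=` B ->
  (Q A <= Q B)%E.
Proof. by move=> mA mB AB; apply: le_measure => //; rewrite inE. Qed.

Lemma null_prob (A B : set T) : measurable A -> measurable B -> A `<=` B ->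
  Q B = 0%E -> Q A = 0%E.
Proof.
by move=> mA mB AB B0; apply/eqP; rewrite -measure_le0 -B0; exact: le_prob.
Qed.

(** The support point is the infimum of the x for which [a, x] has positive probability: a null
    neighbourhood of it, together with a null interval ending inside that neighbourhood, would make
    [a, x] null for some x in this set. *)
Lemma support_point_itv (Z : T -> R) (a b : R) : measurable_fun setT Z ->
  (0 < Q [set w | (a <= Z w <= b)%R])%E ->
  exists2 z, a <= z <= b & support_point Z z.
Proof.
move=> mZ ab0.
have mI (x y : R) : measurable [set w | x <= Z w <= y].
  by rewrite -[X in measurable X]setTI; have :=
    mZ measurableT _ (measurable_itv `[x, y]).
have mI' (z e : R) : measurable [set w | `|Z w - z| < e].
  apply: measurable_lt_set => //.
  by apply: measurableT_comp => //; exact: measurable_funB.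
pose E := [set x | (0 < Q [set w | (a <= Z w <= x)%R])%E].
have Eb : E b by exact: ab0.
clear ab0.
have Ea x : E x -> a <= x.
  rewrite leNgt; apply: contraPN => xa; rewrite /E /=.
  rewrite (_ : [set w | _] = set0); first by rewrite measure0 ltxx.
  by apply/seteqP; split => w //= /andP[h1 h2]; lra.
have Einf : has_inf E by split; [exists b|exists a => x /Ea].
have [infb infa] : inf E <= b /\ a <= inf E.
  by split; [apply: ge_inf => //; exists a => x /Ea|apply: lb_le_inf;
    [exists b|exact: Ea]].
exists (inf E); first by rewrite infa.
move=> e e0; rewrite lt0e measure_ge0 andbT; apply/eqP => Z0.
have [x Ex xe] := inf_adherent e0 Einf.
have nE : ~ E (inf E - e / 2).
  by move=> h; have := ge_inf (ex_intro _ a (fun x h => Ea x h)) h; lra.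
have := Ex; rewrite /E /= lt0e => /andP[/eqP + _]; apply.
apply/eqP; rewrite -measure_le0.
apply: (@le_trans _ _ (Q ([set w | a <= Z w <= inf E - e / 2] `|` [set w | `|Z
  w - inf E| < e]))).
  apply: le_prob => //; first exact: measurableU.
  move=> w /= /andP[h1 h2]; have [h|h] := leP (Z w) (inf E - e / 2).
    by left; rewrite h1.
  by right; rewrite ltr_norml; apply/andP; split; lra.
apply: (@le_trans _ _ (Q [set w | (a <= Z w <= inf E - e / 2)%R] +
    Q [set w | (`|Z w - inf E| < e)%R])%E); first exact: measureU2.
by rewrite Z0 adde0; move/negP: nE; rewrite -leNgt.
Qed.

(** The open half-line is a countable union of compact intervals, so one of them has positive
    probability and [support_point_itv] applies to it. *)
Lemma support_point_lt (Z : T -> R) (t : R) : measurable_fun setT Z ->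
  (0 < Q [set w | (Z w < t)%R])%E -> exists2 z, z < t & support_point Z z.
Proof.
move=> mZ; apply: contraPP => nz.
apply/negP; rewrite -leNgt measure_le0; apply/eqP.
have mI (x y : R) : measurable [set w | x <= Z w <= y].
  by rewrite -[X in measurable X]setTI; have :=
    mZ measurableT _ (measurable_itv `[x, y]).
have E : [set w | Z w < t] `<=` \bigcup_n [set w | t - n%:R <= Z w <= t -
  n.+1%:R^-1].
  move=> w /= wt.
  pose n1 := (Num.truncn (t - Z w)).+1; pose n2 := (Num.truncn (t - Z w)^-1).+1.
  have p : 0 < t - Z w by lra.
  have h1 : t - Z w < n1%:R by exact: truncnS_gt.
  have h2 : (t - Z w)^-1 < n2%:R by exact: truncnS_gt.
  exists (maxn n1 n2) => //=; apply/andP; split.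
    have : n1%:R <= (maxn n1 n2)%:R :> R by rewrite ler_nat leq_maxl.
    by lra.
  have h3 : n2%:R <= (maxn n1 n2).+1%:R :> R by rewrite ler_nat ltnW// ltnS
    leq_maxr.
  rewrite lerBrDr -lerBrDl -[leRHS]invrK lef_pV2 ?posrE ?invr_gt0//.
  by rewrite (le_trans _ h3)// ltW.
apply/eqP; rewrite -measure_le0.
apply: (le_trans (measure_sigma_subadditive _ _ _ E)) => //.
  exact: measurable_lt_set.
rewrite eseries0// => n _ _; apply/eqP; rewrite -measure_le0 leNgt;
  apply/negP => n0.
have [z /andP[_ h] sz] := support_point_itv mZ n0.
apply: nz; exists z => //; rewrite (le_lt_trans h)// ltrBlDr ltrDl.
by rewrite invr_gt0.
Qed.

Lemma support_point_gt (Z : T -> R) (t : R) : measurable_fun setT Z ->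
  (0 < Q [set w | (t < Z w)%R])%E -> exists2 z, t < z & support_point Z z.
Proof.
move=> mZ h; have mN : measurable_fun setT (fun w => - Z w) by exact:
  measurableT_comp.
have [||z zt sz] := @support_point_lt (fun w => - Z w) (- t) => //.
  by under eq_set do rewrite ltrN2.
exists (- z); first by rewrite ltrNr.
move=> e e0; have := sz e e0; congr (_ < Q _)%E; apply/funext => w /=.
by rewrite -normrN; congr (is_true (`|_| < _)); ring.
Qed.

Lemma null_of_mean0 (Y : T -> R) : measurable_fun setT Y ->
  (\int[Q]_w (Y w)%:E = 0)%E -> Q [set w | Y w < 0] = 0%E ->
  Q [set w | 0 < Y w] = 0%E.
Proof.
move=> mY Y0 QY.
have mlt : measurable [set w | Y w < 0].
  exact: measurable_lt_set.
have mgt : measurable [set w | 0 < Y w].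
  exact: measurable_lt_set.
have mEY : measurable_fun setT (EFin \o Y) by exact/measurable_EFinP.
have : (\int[Q]_w `|(EFin \o Y) w| = 0)%E.
  rewrite -Y0; apply: ae_eq_integral => //; first exact: measurableT_comp.
  exists [set w | Y w < 0]; split => // w /= nh; rewrite ltNge; apply/negP => h.
  by apply: nh => _; rewrite ger0_norm.
move/(ae_eq_integral_abs Q measurableT mEY) => [N [mN N0 hN]].
apply: (null_prob mgt mN _ N0) => w /= Yw; apply: hN => /= h.
by move: Yw; rewrite -lte_fin; have /= -> := h I; rewrite ltxx.
Qed.

End support.

Section mean_support.
Context d (T : measurableType d) (R : realType) (Q : probability T R).
Variables (X : {mfun T >-> R}) (Xs : nat -> {mfun T >-> R}).
Hypothesis indep : mutually_independent Q Xs.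
Hypothesis same_law : forall (i : nat) (A : set R), measurable A ->
  distribution Q (Xs i) A = distribution Q X A.

(** The threshold [n0] makes the mesh (q - p) / n smaller than y1 - y0. By independence, with
    positive probability the first [k] samples are all close to [q] and the other n - k all close to
    [p], so that the mean is close to the grid point [y]. *)
Lemma support_point_mean (p q y0 y1 : R) :
  support_point Q X p -> support_point Q X q -> p <= y0 -> y0 < y1 -> y1 <= q ->
  exists n0, forall n, (n0 <= n)%N -> exists2 y, y0 <= y <= y1 &
    support_point Q (fun w => n%:R^-1 * \sum_(i < n) Xs i w) y.
Proof.
move=> sp sq py0 y01 y1q.
have pq : 0 < q - p by lra.
have y10 : 0 < y1 - y0 by lra.
pose n0 := (Num.truncn ((q - p) / (y1 - y0))).+1.
exists n0 => n nn0.
have n0r : (q - p) / (y1 - y0) < n%:R.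
  by rewrite (lt_le_trans (truncnS_gt _))// ler_nat.
have nr0 : 0 < n%:R :> R by rewrite (le_lt_trans _ n0r)// divr_ge0// ltW.
(* The real number of copies of [q] that would give the average y0 exactly; [k] is its floor plus
   one, so [y] lies at most one mesh above y0. *)
pose x := n%:R * (y0 - p) / (q - p).
have x0 : 0 <= x by rewrite divr_ge0 ?mulr_ge0 ?(ltW pq)//; lra.
pose k := (Num.truncn x).+1.
have /andP[kx xk] : x < k%:R <= x + 1.
  rewrite truncnS_gt/= /k -natr1 lerD2r.
  by rewrite truncn_le.
pose y := p + k%:R / n%:R * (q - p).
have yE : y0 <= y <= y1.
  have e : x / n%:R * (q - p) = y0 - p.
    by rewrite /x; field; rewrite (lt0r_neq0 pq) (lt0r_neq0 nr0).
  have h1 : x / n%:R * (q - p) <= k%:R / n%:R * (q - p).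
    by rewrite ler_wpM2r ?(ltW pq)// ler_wpM2r ?invr_ge0 ?(ltW nr0)// ltW.
  have h2 : k%:R / n%:R * (q - p) <= (x + 1) / n%:R * (q - p).
    by rewrite ler_wpM2r ?(ltW pq)// ler_wpM2r ?invr_ge0 ?(ltW nr0).
  have h3 : (q - p) / n%:R <= y1 - y0.
    by rewrite ler_pdivrMr// mulrC -ler_pdivrMr// ltW.
  have e2 : (x + 1) / n%:R * (q - p) = x / n%:R * (q - p) + (q - p) / n%:R by
    ring.
  by rewrite /y; apply/andP; split; lra.
have kn : (k <= n)%N.
  rewrite -(ler_nat R) -(@ler_pM2r _ (n%:R^-1 * (q - p))) ?mulr_gt0 ?invr_gt0//.
  rewrite mulrA [leRHS]mulrA mulfV ?lt0r_neq0// mul1r.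
  by move/andP: yE => []; rewrite /y; lra.
exists y => // e e0.
pose x_ i := if (i < k)%N then q else p.
pose A i := [set z : R | `|z - x_ i| < e].
have mA i : measurable (A i).
  apply: measurable_lt_set => //.
  by apply: measurableT_comp => //; exact: measurable_funB.
have mX i : measurable (Xs i @^-1` A i) by exact: measurable_funPTI.
have pos : (0 < Q [set w | forall i, i \in iota 0 n -> A i (Xs i w)])%E.
  rewrite indep ?iota_uniq//.
  apply: (big_ind (fun x => 0 < x)%E) => //; first by move=> *; exact: mule_gt0.
  move=> i _; rewrite (_ : Q _ = Q (X @^-1` A i)); last exact: same_law.
  rewrite /A /x_; case: ifP => _; [exact: sq|exact: sp].
apply: (lt_le_trans pos); apply: le_prob.
- rewrite [X in measurable X](_ : _ =
      \bigcap_(i in [set i | i \in iota 0 n]) (Xs i @^-1` A i)).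
    by apply: fin_bigcap_measurable => [|i _ //]; exact: finite_seq.
  by apply/seteqP; split => w /= h i /h.
- apply: measurable_lt_set => //; apply: measurableT_comp => //.
  apply: measurable_funB => //.
  by apply: measurable_funM => //; exact: measurable_sum.
move=> w /= hw.
have sx : \sum_(i < n) x_ i = n%:R * y.
  rewrite -(big_mkord xpredT x_) (@big_cat_nat _ _ _ k)//=.
  rewrite (eq_big_nat _ _ (F2 := fun=> q)); last by move=> i /andP[_ h];
    rewrite /x_ h.
  rewrite [X in _ + X](eq_big_nat _ _ (F2 := fun=> p)); last first.
    by move=> i /andP[h _]; rewrite /x_ ltnNge h.
  rewrite !sumr_const_nat subn0 -mulr_natl -[p *+ _]mulr_natl natrB// /y.
  by field; exact: lt0r_neq0.
rewrite (_ : _ - y = n%:R^-1 * \sum_(i < n) (Xs i w - x_ i)); last first.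
  by rewrite sumrB sx; field; exact: lt0r_neq0.
rewrite normrM ger0_norm ?invr_ge0 ?(ltW nr0)//.
rewrite mulrC ltr_pdivrMr//.
apply: (le_lt_trans (ler_norm_sum _ _ _)).
rewrite (_ : e * n%:R = \sum_(i < n) e);
  last by rewrite sumr_const card_ord mulr_natr.
apply: ltr_sum => [|i _].
  by apply/hasP; exists (Ordinal (leq_trans (ltn0Sn _) kn));
    rewrite ?mem_index_enum.
by apply: hw; rewrite mem_iota add0n ltn_ord.
Qed.

End mean_support.

(** * Error sums over the stages *)

Section summation.
Context (R : realType).

Lemma sum_nat_le_geometric (F : nat -> R) (N S : nat) (a M q : R) :
  0 <= a -> 0 <= M -> 0 <= q < 1 ->
  (forall n, F n <= a) -> (forall n, (N <= n)%N -> F n <= M * q ^+ n) ->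
  \sum_(0 <= n < S) F n <= N%:R * a + M * q ^+ N / (1 - q).
Proof.
move=> a0 M0 /andP[q0 q1] Fa Fq.
have q1' : 0 < 1 - q by lra.
(* Strengthened for the induction on [S]: the partial geometric sum is exact once [S] exceeds [N],
   and it vanishes before. *)
suff h : \sum_(0 <= n < S) F n <=
    (minn S N)%:R * a + M * (q ^+ N - q ^+ maxn S N) / (1 - q).
  apply: (le_trans h); apply: lerD.
    by rewrite ler_wpM2r// ler_nat geq_minr.
  rewrite ler_wpM2r ?invr_ge0 ?(ltW q1')// ler_wpM2l//.
  by have := exprn_ge0 (maxn S N) q0; lra.
elim: S => [|S IH].
  by rewrite big_geq// min0n max0n subrr mulr0 mul0r mul0r addr0.
rewrite big_nat_recr//=; have [SN|NS] := ltnP S N.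
  move: IH; rewrite (minn_idPl (ltnW SN)) (maxn_idPr (ltnW SN)).
  rewrite (minn_idPl SN) (maxn_idPr SN) -natr1 => IH.
  by have := Fa S; lra.
move: IH; rewrite (minn_idPr NS) (maxn_idPl NS).
rewrite (minn_idPr (leqW NS)) (maxn_idPl (leqW NS)) => IH.
have := Fq _ NS => h.
have -> : M * (q ^+ N - q ^+ S.+1) / (1 - q) =
   M * (q ^+ N - q ^+ S) / (1 - q) + M * q ^+ S.
  by rewrite exprS; field; exact: lt0r_neq0.
by lra.
Qed.

Lemma sum_increasing_le (F : nat -> R) (n : nat -> nat) (s : nat) :
  (forall k, 0 <= F k) -> (forall l, (1 <= l < s)%N -> (n l < n l.+1)%N) ->
  \sum_(1 <= l < s.+1) F (n l) <= \sum_(0 <= k < (n s).+1) F k.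
Proof.
move=> F0; elim: s => [|s IH] nS.
  by rewrite big_geq//; apply: sumr_ge0 => *.
have {}IH : \sum_(1 <= l < s.+1) F (n l) <= \sum_(0 <= k < (n s).+1) F k.
  by apply: IH => l /andP[l1 ls]; apply: nS; rewrite l1 ltnW.
rewrite big_nat_recr//= [leRHS]big_nat_recr//= lerD2r.
case: s IH nS => [|s] IH nS; first by rewrite big_geq//; apply: sumr_ge0 => *.
have lt : (n s.+1 < n s.+2)%N by apply: nS; rewrite ltnS leqnn.
rewrite (le_trans IH)// [leRHS](@big_cat_nat _ _ _ (n s.+1).+1)//=.
by rewrite lerDl; apply: sumr_ge0 => *.
Qed.

(** The stage sizes are distinct, so the sum over stages is part of the sum over all n, whatever the
    growth of [s z]. *)
Lemma sum_stages_small (u : nat -> R -> \bar R) (s : R -> nat)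
    (ns : R -> nat -> nat) (B M q : R) (n0 : nat) :
  0 <= M -> 0 <= q < 1 ->
  (forall n z, 0 <= u n z)%E ->
  (\forall z \near 0^'+, forall n, (0 < n)%N -> (u n z <= (B * z)%:E)%E /\
     ((n0 <= n)%N -> (u n z <= (M * q ^+ n)%:E)%E)) ->
  (forall z, 0 < z -> [/\ (0 < s z)%N, (0 < ns z 1)%N &
     forall l, (1 <= l < s z)%N -> (ns z l < ns z l.+1)%N]) ->
  forall e, 0 < e -> \forall z \near 0^'+,
    (\sum_(1 <= l < (s z).+1) u (ns z l) z <= e%:E)%E.
Proof.
move=> M0 q01 u0 uz hns e e0; have /andP[q0 q1] := q01.
have q1' : 0 < 1 - q by lra.
(* [N] is fixed before [z]; the first [N] terms, each at most B z, are then made small through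
   [z]. *)
have [N NE n0N] : exists2 N, M * q ^+ N / (1 - q) <= e / 2 & (n0 <= N)%N.
  have : (fun n => M * q ^+ n / (1 - q)) @ \oo --> M * 0 / (1 - q).
    apply: cvgMl; apply: cvgMr; apply: cvg_expr.
    by rewrite ger0_norm.
  rewrite mulr0 mul0r => /cvgrPdist_le /(_ (e / 2)); rewrite divr_gt0// =>
    /(_ isT).
  case=> N _ hN; exists (maxn N n0); last exact: leq_maxr.
  have := hN (maxn N n0) (leq_maxl _ _); rewrite /= sub0r normrN => h.
  by rewrite (le_trans _ h)// ler_norm.
pose B' := Num.max B 0.
have B'0 : 0 <= B' by rewrite le_max lexx orbT.
have p : 0 < N.+1%:R * (B' + 1) by rewrite mulr_gt0//; lra.
have d0 : 0 < (e / 2) / (N.+1%:R * (B' + 1)) by rewrite divr_gt0// divr_gt0.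
near=> z.
have z0 : 0 < z by near: z; exact: nbhs_right_gt.
have Bz : N.+1%:R * (B' * z) <= e / 2.
  have : z <= (e / 2) / (N.+1%:R * (B' + 1)).
    by near: z; exact: nbhs_right_le.
  rewrite ler_pdivlMr// => h; rewrite (le_trans _ h)//.
  rewrite [leRHS]mulrCA ler_wpM2l//.
  by have := ltW z0; nra.
have [s0 n10 nS] := hns z z0.
have uz' : forall n, (0 < n)%N -> (u n z <= (B * z)%:E)%E /\
     ((n0 <= n)%N -> (u n z <= (M * q ^+ n)%:E)%E) by near: z.
have ufin n : (0 < n)%N -> u n z \is a fin_num.
  by move=> n1; rewrite ge0_fin_numE// (le_lt_trans (uz' n n1).1)// ltry.
have nl0 l : (1 <= l <= s z)%N -> (0 < ns z l)%N.
  elim: l => // -[|l] IH // /andP[_ ls].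
  by apply: (leq_ltn_trans _ (nS l.+1 ls)).
(* The bounds on [u] are available for n > 0 only; no stage has size 0. *)
pose F n := if n == 0%N then 0 else fine (u n z).
have -> : (\sum_(1 <= l < (s z).+1) u (ns z l) z =
    (\sum_(1 <= l < (s z).+1) F (ns z l))%:E)%E.
  rewrite -sumEFin; apply: eq_big_nat => l l1.
  by rewrite /F -leqn0 leqNgt nl0//= fineK// ufin// nl0.
rewrite lee_fin; apply: (@le_trans _ _ (\sum_(0 <= k < (ns z (s z)).+1) F k)).
  by apply: sum_increasing_le => // k; rewrite /F; case: ifP => // _; exact:
    fine_ge0.
have Bz0 : 0 <= B' * z by rewrite mulr_ge0// ltW.
apply: (le_trans (@sum_nat_le_geometric F N _ (B' * z) M q _ _ _ _ _)) => //.
- move=> n; rewrite /F; case: eqP => // /eqP; rewrite -lt0n => n1.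
  rewrite -lee_fin fineK ?ufin// (le_trans (uz' n n1).1)// lee_fin.
  by rewrite ler_wpM2r ?(ltW z0)// le_max lexx.
- move=> n Nn; rewrite /F; case: eqP => [_|/eqP].
    by rewrite mulr_ge0// exprn_ge0.
  rewrite -lt0n => n1; rewrite -lee_fin fineK ?ufin//.
  by apply: (uz' n n1).2; exact: leq_trans Nn.
have : N%:R * (B' * z) <= N.+1%:R * (B' * z) by rewrite ler_wpM2r// ler_nat.
by lra.
Unshelve. all: by end_near. Qed.

Lemma cvg0_of_le (u : R -> \bar R) : (forall z, 0 <= u z)%E ->
  (forall e, 0 < e -> \forall z \near 0^'+, (u z <= e%:E)%E) ->
  u z @[z --> 0^'+] --> 0%E.
Proof.
move=> u0 ue; apply/fine_cvgP; split.
  have := ue 1 ltr01; apply: filterS => z uz.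
  by rewrite ge0_fin_numE// (le_lt_trans uz)// ltry.
apply/cvgrPdist_le => e e0; have := ue e e0; apply: filterS => z uz.
rewrite /= sub0r normrN ger0_norm ?fine_ge0// -lee_fin fineK//.
by rewrite ge0_fin_numE// (le_lt_trans uz)// ltry.
Qed.

End summation.

(** * The quantile bounds f and g *)

Section quantile_bounds.
Context d (T : measurableType d) (R : realType).
Variables (Theta : set R) (P : R -> probability T R) (Z : T -> R).
Hypothesis mZ : measurable_fun setT Z.

Lemma f_le (t a : R) : (f_ Theta P Z t a <= t%:E)%E.
Proof. by apply: ge_ereal_sup => _ [y [_ _ yt] <-]; rewrite lee_fin. Qed.

Lemma g_ge (t a : R) : (t%:E <= g_ Theta P Z t a)%E.
Proof. by apply: le_ereal_inf_tmp => _ [y [_ _ yt] <-]; rewrite lee_fin. Qed.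

Lemma f_under_le (t1 t2 a b : R) :
  (f_under Theta P Z t1 t2 a b <= f_ Theta P Z t2 b)%E.
Proof. by rewrite /f_under ge_min lexx. Qed.

Lemma g_over_ge (t1 t2 a b : R) :
  (g_ Theta P Z t1 a <= g_over Theta P Z t1 t2 a b)%E.
Proof. by rewrite /g_over le_max lexx. Qed.

Lemma measurable_lee_set (x : \bar R) : measurable [set w | ((Z w)%:E <= x)%E].
Proof.
case: x => [x| |].
- rewrite (_ : [set w | _] = [set w | Z w <= x]); last first.
    by apply/funext => w /=; rewrite lee_fin.
  exact: measurable_le_set.
- rewrite (_ : [set w | _] = setT)//.
  by apply/seteqP; split => w //= _; rewrite leey.
- rewrite (_ : [set w | _] = set0)//.
  by apply/seteqP; split.
Qed.

Lemma measurable_lte_set (x : \bar R) : measurable [set w | (x < (Z w)%:E)%E].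
Proof.
rewrite (_ : [set w | _] = ~` [set w | ((Z w)%:E <= x)%E]).
  exact/measurableC/measurable_lee_set.
apply/seteqP; split => w /=; last by move/negP; rewrite -ltNge.
by move=> h; apply/negP; rewrite -ltNge.
Qed.

Hypothesis attained : extrema_attained Theta P Z.

Lemma f_cases (t a : R) : Theta t -> 0 < a < 1 ->
  f_ Theta P Z t a = -oo%E \/
  exists2 z, lower_set Theta P Z t a z & f_ Theta P Z t a = z%:E.
Proof.
move=> Tt a01; have [/((attained Tt a01).1)[z Lz ub]|L0] :=
  pselect (lower_set Theta P Z t a !=set0).
  by right; exists z => //; exact: f_maxE.
left; rewrite /f_; move/set0P/negP/negPn/eqP: L0 => ->.
by rewrite image_set0 ereal_sup0.
Qed.

Lemma g_cases (t a : R) : Theta t -> 0 < a < 1 ->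
  g_ Theta P Z t a = +oo%E \/
  exists2 z, upper_set Theta P Z t a z & g_ Theta P Z t a = z%:E.
Proof.
move=> Tt a01; have [/((attained Tt a01).2)[z Lz lb]|L0] :=
  pselect (upper_set Theta P Z t a !=set0).
  by right; exists z => //; exact: g_minE.
left; rewrite /g_; move/set0P/negP/negPn/eqP: L0 => ->.
by rewrite image_set0 ereal_inf0.
Qed.

(** Attainment matters: [F_] is not left-continuous, so its bound on [lower_set] would not pass to a
    supremum outside the set. *)
Lemma prob_le_f (t a : R) : Theta t -> 0 < a < 1 ->
  (P t [set w | ((Z w)%:E <= f_ Theta P Z t a)%E] <= a%:E)%E.
Proof.
move=> Tt a01; have [->|[z [_ Fz _] ->]] := f_cases Tt a01; last exact: Fz.
rewrite (_ : [set w | _] = set0); last by apply/seteqP; split.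
by rewrite measure0 lee_fin ltW//; case/andP: a01.
Qed.

Lemma prob_ge_g (t a : R) : Theta t -> 0 < a < 1 ->
  (P t [set w | (g_ Theta P Z t a < (Z w)%:E)%E] <= a%:E)%E.
Proof.
move=> Tt a01; have [->|[z [_ Gz _] ->]] := g_cases Tt a01; last first.
  apply: le_trans Gz; apply: le_prob => //.
  - exact: measurable_lte_set.
  - exact: measurable_le_set.
  - by move=> w /=; rewrite lte_fin => /ltW.
rewrite (_ : [set w | _] = set0); last first.
  by apply/seteqP; split => w //=; rewrite ltNge leey.
by rewrite measure0 lee_fin ltW//; case/andP: a01.
Qed.

Lemma null_cover_absurd (t a : R) (A B : set T) :
  measurable A -> measurable B ->
  A `|` B = setT -> P t A = 0%E -> (P t B <= a%:E)%E -> a < 1 -> False.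
Proof.
move=> mA mB AB A0 Ba a1.
have : (P t setT <= P t A + P t B)%E by rewrite -AB; exact: measureU2.
rewrite A0 add0e probability_setT => h.
by have := le_lt_trans (le_trans h Ba) (_ : (a%:E < 1%:E)%E);
  rewrite ltxx lte_fin => /(_ a1).
Qed.

(** Degenerate case Z = t almost surely. If f < t the event lies in {Z < t}; and f = t is
    impossible, as [F_] at t would be 1 > a. *)
Lemma prob_le_f_null (t a : R) : Theta t -> 0 < a < 1 ->
  P t [set w | Z w < t] = 0%E -> P t [set w | t < Z w] = 0%E ->
  P t [set w | ((Z w)%:E <= f_ Theta P Z t a)%E] = 0%E.
Proof.
move=> Tt a01 lt0 gt0; have [->|[z [_ Fz zt] ->]] := f_cases Tt a01.
  by rewrite (_ : [set w | _] = set0) ?measure0//; apply/seteqP; split.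
have [zlt|] := ltP z t.
  apply: null_prob lt0; [exact: measurable_lee_set|exact: measurable_lt_set|].
  by move=> w /=; rewrite lee_fin => h; exact: le_lt_trans zlt.
move=> tz; exfalso; have {tz zt} zt : z = t by apply/eqP; rewrite eq_le zt.
move: Fz; rewrite zt => Fz; apply: (null_cover_absurd _ _ _ gt0 Fz).
- exact: measurable_lt_set.
- exact: measurable_le_set.
- by apply/seteqP; split => w //= _; have [|] := leP (Z w) t; [right|left].
- by case/andP: a01.
Qed.

Lemma prob_ge_g_null (t a : R) : Theta t -> 0 < a < 1 ->
  P t [set w | Z w < t] = 0%E -> P t [set w | t < Z w] = 0%E ->
  P t [set w | (g_ Theta P Z t a < (Z w)%:E)%E] = 0%E.
Proof.
move=> Tt a01 lt0 gt0; apply: null_prob gt0.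
- exact: measurable_lte_set.
- exact: measurable_lt_set.
- by move=> w /=; rewrite -lte_fin; apply: le_lt_trans; exact: g_ge.
Qed.

(** As f <= t2 and g <= y, a possible value y < t2 with a small upper tail at t1 keeps [f_under] at
    distance at least (t2 - y) / 2 from t2. *)
Lemma f_under_midpoint (t1 t2 a b y : R) : upper_set Theta P Z t1 a y ->
  (f_under Theta P Z t1 t2 a b <= ((t2 + y) / 2)%:E)%E.
Proof.
move=> Uy; rewrite /f_under ge_min; apply/orP; right.
rewrite mulrC EFinM; apply: lee_wpmul2l; first by rewrite lee_fin invr_ge0.
by rewrite EFinD; apply: leeD; [exact: f_le|apply: ereal_inf_lbound; exists y].
Qed.

Lemma g_over_midpoint (t1 t2 a b y : R) : lower_set Theta P Z t2 b y ->
  (((y + t1) / 2)%:E <= g_over Theta P Z t1 t2 a b)%E.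
Proof.
move=> Ly; rewrite /g_over le_max; apply/orP; right.
rewrite mulrC EFinM; apply: lee_wpmul2l; first by rewrite lee_fin invr_ge0.
by rewrite EFinD; apply: leeD; [apply: ereal_sup_ubound; exists y|exact: g_ge].
Qed.

End quantile_bounds.

(** * Geometric rates for the one-stage errors of the sample mean *)

Section rates.
Context d (T : measurableType d) (R : realType).

(** If K^n <= a z the rate [r] applies directly. Otherwise A z < a z < K^n, with [A] the positive
    lower constant of [order_zeta a], and B z <= (B / A) K^n. The constants M = 1 + B / A and q =
    max K r serve both cases. *)
Lemma rate_split (u : nat -> R -> \bar R) (a b : R -> R) (K r : R) (n0 : nat) :
  order_zeta a -> order_zeta b -> 0 <= K < 1 -> 0 <= r < 1 ->
  (forall n z, (0 < n)%N -> 0 < z -> (u n z <= (b z)%:E)%E) ->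
  (forall n z, (0 < n)%N -> 0 < z -> (n0 <= n)%N -> K ^+ n <= a z ->
     (u n z <= (r ^+ n)%:E)%E) ->
  exists B M q, [/\ 0 <= M, 0 <= q < 1 & \forall z \near 0^'+,
    forall n, (0 < n)%N -> (u n z <= (B * z)%:E)%E /\
      ((n0 <= n)%N -> (u n z <= (M * q ^+ n)%:E)%E)].
Proof.
move=> [A [A' [A0 Aa]]] [B0' [B' [_ bB]]] /andP[K0 K1] /andP[r0 r1] ub ur.
pose B := Num.max B' 0.
have B0 : 0 <= B by rewrite le_max lexx orbT.
have M1 : 1 <= 1 + B / A by rewrite lerDl divr_ge0// ltW.
exists B, (1 + B / A), (Num.max K r); split.
- by rewrite (le_trans ler01).
- by rewrite le_max K0 gt_max K1.
near=> z => n n0'.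
have z0 : 0 < z by near: z; exact: nbhs_right_gt.
have Aaz : A < a z / z by near: z; move: Aa; apply: filterS => z /andP[].
have bBz : b z / z < B' by near: z; move: bB; apply: filterS => z /andP[].
have bz : b z <= B * z.
  by rewrite -ler_pdivrMr// (le_trans (ltW bBz))// le_max lexx.
have uB : (u n z <= (B * z)%:E)%E by rewrite (le_trans (ub n z n0' z0))//
  lee_fin.
split=> // nn.
have [Ka|aK] := leP (K ^+ n) (a z).
  rewrite (le_trans (ur n z n0' z0 nn Ka))// lee_fin.
  rewrite -[leLHS]mul1r ler_pM ?exprn_ge0//.
  by rewrite lerXn2r ?nnegrE ?le_max ?r0 ?orbT// lexx orbT.
rewrite (le_trans uB)// lee_fin.
have zK : z <= K ^+ n / A.
  rewrite ler_pdivlMr// mulrC; move: Aaz; rewrite ltr_pdivlMr// => h.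
  by rewrite ltW// (lt_trans h).
apply: (@le_trans _ _ (B / A * K ^+ n)).
  by rewrite -mulrA [_^-1 * _]mulrC ler_wpM2l.
rewrite ler_pM ?exprn_ge0 ?divr_ge0 ?(ltW A0)//; first by rewrite lerDr.
by rewrite lerXn2r ?nnegrE ?le_max ?K0 ?lexx.
Unshelve. all: by end_near. Qed.

Variables (Theta : set R) (P : R -> probability T R).
Variables (X : {mfun T >-> R}) (Xs : nat -> {mfun T >-> R}).
Hypothesis same_law : identical_samples Theta P X Xs.
Hypothesis indep : forall t, Theta t -> mutually_independent (P t) Xs.
Hypothesis mgf : forall t r, Theta t ->
  (P t).-integrable setT (fun w => (expR (r * X w))%:E).
Hypothesis mean : forall t, Theta t -> (\int[P t]_w (X w)%:E = t%:E)%E.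

Let Z n (w : T) := n%:R^-1 * \sum_(i < n) Xs i w.
Hypothesis attained : forall n, (0 < n)%N -> extrema_attained Theta P (Z n).

Let mZ n : measurable_fun setT (Z n).
Proof. by apply: measurable_funM => //; exact: measurable_sum. Qed.

Lemma null_some_sample (t : R) (A : set R) (n : nat) : Theta t ->
  measurable A -> P t (X @^-1` A) = 0%E ->
  forall B, measurable B -> B `<=` [set w | exists i : 'I_n, A (Xs i w)] ->
  P t B = 0%E.
Proof.
move=> Tt mA A0 B mB BA; apply/eqP; rewrite -measure_le0.
have BA' : B `<=` \bigcup_i (Xs i @^-1` A) by move=> w /BA[i Ai]; exists i.
apply: (le_trans (measure_sigma_subadditive _ _ _ BA')) => //.
  by move=> i; exact: measurable_funPTI.
rewrite eseries0// => i _ _; rewrite -[RHS]A0.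
exact: (same_law Tt i mA).
Qed.

(** Since X - t has mean 0, it is null on one side of 0 only if it is null on both. Either X = t
    almost surely, and then every sample mean equals t almost surely, or X has mass, hence support
    points, on both sides of t. *)
Lemma mean_dichotomy (t : R) : Theta t ->
  (forall n, (0 < n)%N -> P t [set w | Z n w < t] = 0%E /\
     P t [set w | t < Z n w] = 0%E) \/
  (exists p q, [/\ p < t, t < q, support_point (P t) X p &
     support_point (P t) X q]).
Proof.
move=> Tt.
have iX : (P t).-integrable setT (fun w => (X w)%:E).
  by apply: integrable_mgf => r; exact: mgf.
have ic : (P t).-integrable setT (fun=> (- t)%:E : \bar R).
  exact: finite_measure_integrable_cst.
have E1 (x : R) : (\int[P t]_w (x%:E : \bar R) = x%:E)%E.
  by rewrite integral_cst// -[RHS]mule1; congr (_ * _)%E; exact: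
    probability_setT.
have E0 : (\int[P t]_w (X w - t)%:E = 0)%E.
  transitivity (\int[P t]_w ((X w)%:E + (- t)%:E))%E; first by [].
  by rewrite integralD// E1 mean// -EFinD subrr.
have E0' : (\int[P t]_w (t - X w)%:E = 0)%E.
  transitivity (\int[P t]_w ((-1)%:E * (X w - t)%:E))%E.
    by apply: eq_integral => w _; rewrite -EFinM; congr EFin; ring.
  rewrite integralZl//; first by rewrite E0 mule0.
  exact: (integrableD measurableT iX ic).
have m1 : measurable_fun setT (fun w => X w - t) by exact: measurable_funB.
have m2 : measurable_fun setT (fun w => t - X w) by exact: measurable_funB.
have s1 : [set w | X w - t < 0] = [set w | X w < t].
  by apply/funext => w /=; rewrite subr_lt0.
have s2 : [set w | 0 < X w - t] = [set w | t < X w].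
  by apply/funext => w /=; rewrite subr_gt0.
have s3 : [set w | t - X w < 0] = [set w | t < X w].
  by apply/funext => w /=; rewrite subr_lt0.
have s4 : [set w | 0 < t - X w] = [set w | X w < t].
  by apply/funext => w /=; rewrite subr_gt0.
have h1 := null_of_mean0 m1 E0; rewrite s1 s2 in h1.
have h2 := null_of_mean0 m2 E0'; rewrite s3 s4 in h2.
have degenerate : P t [set w | X w < t] = 0%E -> P t [set w | t < X w] = 0%E ->
  forall n, (0 < n)%N -> P t [set w | Z n w < t] = 0%E /\
     P t [set w | t < Z n w] = 0%E.
  move=> l0 g0 n n0; have nr0 : 0 < n%:R :> R by rewrite ltr0n.
  have nE : n%:R * t = \sum_(i < n) t by rewrite sumr_const card_ord mulr_natl.
  split.
    apply: (@null_some_sample t `]-oo, t[%classic n) => //.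
      exact: measurable_lt_set.
    move=> w /=; rewrite /Z; apply: contraPP => /forallNP h; apply/negP.
    rewrite -leNgt mulrC ler_pdivlMr// mulrC nE; apply: ler_sum => i _.
    by have := h i; rewrite /= in_itv /= => /negP; rewrite -leNgt.
  apply: (@null_some_sample t `]t, +oo[%classic n) => //.
  - by rewrite -g0; congr (P t _); apply/funext => w /=;
    rewrite in_itv /= andbT.
  - exact: measurable_lt_set.
  move=> w /=; rewrite /Z; apply: contraPP => /forallNP h; apply/negP.
  rewrite -leNgt mulrC ler_pdivrMr// mulrC nE; apply: ler_sum => i _.
  by have := h i; rewrite /= in_itv /= andbT => /negP; rewrite -leNgt.
have [l0|l0] := eqVneq (P t [set w | X w < t]) 0%E.
  by left; apply: degenerate => //; exact: h1.
have [g0|g0] := eqVneq (P t [set w | t < X w]) 0%E.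
  by left; apply: degenerate => //; exact: h2.
right.
have [p pt sp] : exists2 p, p < t & support_point (P t) X p.
  by apply: support_point_lt => //; rewrite lt0e l0/=.
have [q qt sq] : exists2 q, t < q & support_point (P t) X q.
  by apply: support_point_gt => //; rewrite lt0e g0/=.
by exists p, q.
Qed.

Lemma chernoff_sample_mean (t sg c : R) : Theta t -> 0 < c ->
  exists2 K, 0 <= K < 1 & forall n, (0 < n)%N ->
    (P t [set w | (c <= sg * (Z n w - t))%R] <= (K ^+ n)%:E)%E.
Proof.
move=> Tt c0; apply: (chernoff_mean (indep Tt) (same_law Tt)) => //.
- by move=> r; exact: mgf.
- exact: mean.
Qed.

Lemma lower_error_rate (t1 t2 : R) (a b : R -> R) : Theta t1 -> Theta t2 ->
  t1 < t2 -> order_zeta a -> order_zeta b ->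
  (forall z, 0 < z -> 0 < a z < 1) -> (forall z, 0 < z -> 0 < b z < 1) ->
  exists n0 B M q, [/\ 0 <= M, 0 <= q < 1 & \forall z \near 0^'+,
    forall n, (0 < n)%N ->
    let E := [set w | ((Z n w)%:E <=
                       f_under Theta P (Z n) t1 t2 (a z) (b z))%E] in
    (P t2 E <= (B * z)%:E)%E /\ ((n0 <= n)%N -> (P t2 E <= (M * q ^+ n)%:E)%E)].
Proof.
move=> T1 T2 t12 oa ob a01 b01.
pose u n z := P t2 [set w | ((Z n w)%:E <=
  f_under Theta P (Z n) t1 t2 (a z) (b z))%E].
have uf n z : (u n z <= P t2 [set w | ((Z n w)%:E <= f_ Theta P (Z n) t2 (b
  z))%E])%E.
  apply: le_prob; [exact: measurable_lee_set|exact: measurable_lee_set|].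
  by move=> w /= h; apply: (le_trans h); exact: f_under_le.
have ub n z : (0 < n)%N -> 0 < z -> (u n z <= (b z)%:E)%E.
  by move=> n0 z0; apply: (le_trans (uf n z)); apply: prob_le_f;
    [exact: attained| |exact: b01].
have [deg|[p [q [pt qt sp sq]]]] := mean_dichotomy T2.
  have h01 : 0 <= (0 : R) < (1 : R) by rewrite lexx ltr01.
  (* The error is null here, so the rates K = r = 0 are enough. *)
  have [|B [M [q hq]]] := @rate_split u a b 0 0 0 oa ob h01 h01 ub; last first.
    by exists 0%N, B, M, q.
  move=> n z n0 z0 _ _; apply: (le_trans (uf n z)); have [l0 g0] := deg n n0.
  by rewrite prob_le_f_null ?lee_fin ?exprn_ge0//; [exact: attained|exact: b01].
(* [y] must stay above [t1], for Chernoff's bound there, and above [p], to be reachable as an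
   average; it is taken in the middle third between [m0] and [t2]. *)
pose m0 := Num.max p t1.
have m0t : m0 < t2 by rewrite gt_max pt.
have pm0 : p <= m0 by rewrite le_max lexx.
have tm0 : t1 <= m0 by rewrite le_max lexx orbT.
have [n0 hn0] : exists n0, forall n, (n0 <= n)%N ->
    exists2 y, (m0 + (t2 - m0) / 3) <= y <= (m0 + 2 * (t2 - m0) / 3) &
    support_point (P t2) (Z n) y.
  by apply: (support_point_mean (indep T2) (same_law T2) sp sq); lra.
(* The least distance from [t1] to [y]. As [y] is at least (t2 - m0) / 3 below [t2], the midpoint of
   the two is at least (t2 - m0) / 6 below, whence the 6 in the next constant. *)
have c1 : 0 < m0 + (t2 - m0) / 3 - t1 by lra.
have c2 : 0 < (t2 - m0) / 6 by lra.
have [K K01 hK] := chernoff_sample_mean 1 T1 c1.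
have [r r01 hr] := chernoff_sample_mean (-1) T2 c2.
have [|B [M [q' hq]]] := @rate_split u a b K r n0 oa ob K01 r01 ub; last first.
  by exists n0, B, M, q'.
move=> n z n1 z0 nn Ka; have [y /andP[y0 y1] sy] := hn0 n nn.
have Uy : upper_set Theta P (Z n) t1 (a z) y.
  split; last by lra.
  (* A support point under [t2] counts as a possible value, although the tail is bounded under
     [t1]. *)
  - by exists t2.
  - apply: (@le_trans _ _ (K ^+ n)%:E); last by rewrite lee_fin.
    apply: (le_trans _ (hK n n1)); apply: le_prob.
    + exact: measurable_le_set.
    + apply: measurable_le_set => //; apply: measurable_funM => //.
      exact: measurable_funB.
    + by move=> w /= h; lra.
apply: (le_trans _ (hr n n1)); apply: le_prob.
- exact: measurable_lee_set.
- apply: measurable_le_set => //; apply: measurable_funM => //.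
  exact: measurable_funB.
- move=> w /= h; have := le_trans h (f_under_midpoint _ _ Uy).
  by rewrite lee_fin => {}h; lra.
Qed.

(** Mirror image of [lower_error_rate]: now K^n is compared with [b], the O(zeta) bound comes from
    [a], and the possible value bounds f from below. *)
Lemma upper_error_rate (t1 t2 : R) (a b : R -> R) : Theta t1 -> Theta t2 ->
  t1 < t2 -> order_zeta a -> order_zeta b ->
  (forall z, 0 < z -> 0 < a z < 1) -> (forall z, 0 < z -> 0 < b z < 1) ->
  exists n0 B M q, [/\ 0 <= M, 0 <= q < 1 & \forall z \near 0^'+,
    forall n, (0 < n)%N ->
    let E := [set w | (g_over Theta P (Z n) t1 t2 (a z) (b z) <
                       (Z n w)%:E)%E] in
    (P t1 E <= (B * z)%:E)%E /\ ((n0 <= n)%N -> (P t1 E <= (M * q ^+ n)%:E)%E)].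
Proof.
move=> T1 T2 t12 oa ob a01 b01.
pose u n z := P t1 [set w | (g_over Theta P (Z n) t1 t2 (a z) (b z) <
  (Z n w)%:E)%E].
have ug n z : (u n z <= P t1 [set w | (g_ Theta P (Z n) t1 (a z) < (Z n
  w)%:E)%E])%E.
  apply: le_prob; [exact: measurable_lte_set|exact: measurable_lte_set|].
  by move=> w /=; apply: le_lt_trans; exact: g_over_ge.
have ua n z : (0 < n)%N -> 0 < z -> (u n z <= (a z)%:E)%E.
  by move=> n0 z0; apply: (le_trans (ug n z)); apply: prob_ge_g;
    [by []|exact: attained| |exact: a01].
have [deg|[p [q [pt qt sp sq]]]] := mean_dichotomy T1.
  have h01 : 0 <= (0 : R) < (1 : R) by rewrite lexx ltr01.
  have [|B [M [q hq]]] := @rate_split u b a 0 0 0 ob oa h01 h01 ua; last first.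
    by exists 0%N, B, M, q.
  move=> n z n0 z0 _ _; apply: (le_trans (ug n z)); have [l0 g0] := deg n n0.
  by rewrite prob_ge_g_null ?lee_fin ?exprn_ge0//; exact: a01.
pose m0 := Num.min q t2.
have m0t : t1 < m0 by rewrite lt_min qt.
have pm0 : m0 <= q by rewrite ge_min lexx.
have tm0 : m0 <= t2 by rewrite ge_min lexx orbT.
have [n0 hn0] : exists n0, forall n, (n0 <= n)%N ->
    exists2 y, (t1 + (m0 - t1) / 3) <= y <= (t1 + 2 * (m0 - t1) / 3) &
    support_point (P t1) (Z n) y.
  by apply: (support_point_mean (indep T1) (same_law T1) sp sq); lra.
have c1 : 0 < t2 - (t1 + 2 * (m0 - t1) / 3) by lra.
have c2 : 0 < (m0 - t1) / 6 by lra.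
have [K K01 hK] := chernoff_sample_mean (-1) T2 c1.
have [r r01 hr] := chernoff_sample_mean 1 T1 c2.
have [|B [M [q' hq]]] := @rate_split u b a K r n0 ob oa K01 r01 ua; last first.
  by exists n0, B, M, q'.
move=> n z n1 z0 nn Kb; have [y /andP[y0 y1] sy] := hn0 n nn.
have Ly : lower_set Theta P (Z n) t2 (b z) y.
  split; last by lra.
  - by exists t1.
  - apply: (@le_trans _ _ (K ^+ n)%:E); last by rewrite lee_fin.
    apply: (le_trans _ (hK n n1)); apply: le_prob.
    + exact: measurable_le_set.
    + apply: measurable_le_set => //; apply: measurable_funM => //.
      exact: measurable_funB.
    + by move=> w /= h; lra.
apply: (le_trans _ (hr n n1)); apply: le_prob.
- exact: measurable_lte_set.
- apply: measurable_le_set => //; apply: measurable_funM => //.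
  exact: measurable_funB.
- move=> w /= h; have := le_lt_trans (g_over_midpoint _ _ Ly) h.
  by rewrite lte_fin => {}h; lra.
Qed.

End rates.

(** * Comparison of probabilities through the likelihood *)

Section likelihood_comparison.
Context d (T : measurableType d) (R : realType).
Variables (Theta : set R) (P : R -> probability T R) (Xs :
  nat -> {mfun T >-> R}).

Lemma measurable_observation (n : nat) : measurable_fun setT (observation Xs n).
Proof.
apply/measurable_fun_tnthP => i.
rewrite (_ : _ \o _ = Xs i)//.
by apply/funext => w /=; rewrite tnth_mktuple.
Qed.

Lemma measurable_observation_eq (n : nat) (x : n.-tuple R) :
  measurable [set w | observation Xs n w = x].
Proof.
rewrite (_ : [set w | _] =
    \bigcap_(i in [set: 'I_n]) (Xs i @^-1` [set tnth x i])).
  by apply: fin_bigcap_measurable => // i _; exact: measurable_funPTI.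
apply/seteqP; split => w /=.
  by move=> <- i _ /=; rewrite tnth_mktuple.
by move=> h; apply: eq_from_tnth => i; rewrite tnth_mktuple; exact: h.
Qed.

(** Up to a null set for [t1], the event splits into countably many atoms, on each of which the pmf
    inequality is the claim. Carriers [C] are chosen for [t1] only: at [t2] it suffices that the
    atoms lie in the event. *)
Lemma pmf_comparison (n : nat) (L : R -> n.-tuple R -> R) (t1 t2 : R)
    (B : set (n.-tuple R)) :
  joint_pmf Theta P Xs L -> Theta t1 -> Theta t2 -> measurable B ->
  (forall w, B (observation Xs n w) ->
     L t1 (observation Xs n w) <= L t2 (observation Xs n w)) ->
  (P t1 (observation Xs n @^-1` B) <= P t2 (observation Xs n @^-1` B))%E.
Proof.
move=> pmfL T1 T2 mB LB.
have [conc L1] := pmfL t1 T1; have [_ L2] := pmfL t2 T2.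
have /choice[C hC] : forall i, exists C : set R,
    countable C /\ P t1 (Xs i @^-1` C) = 1%E.
  by move=> i; have [C ? ?] := conc i; exists C.
have /choice[f hf] : forall i, exists f : R -> nat, {in C i &, injective f}.
  by move=> i; have /countable_injP[f hf] := (hC i).1; exists f.
pose S := [set x : n.-tuple R | forall i : 'I_n, C i (tnth x i)].
(* Injective on [S], so [F k] is empty or the event of a single observed tuple. *)
pose c (x : n.-tuple R) := pickle [tuple f i (tnth x i) | i < n].
have cI x y : S x -> S y -> c x = c y -> x = y.
  move=> Sx Sy /(pcan_inj pickleK) exy; apply: eq_from_tnth => i.
  have := congr1 (fun u => tnth u i) exy; rewrite !tnth_mktuple.
  by apply: hf; apply/mem_set; [exact: Sx|exact: Sy].
have mC i : measurable (C i) by apply: countable_measurable => //; exact: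
  (hC i).1.
pose F k := [set w | [/\ B (observation Xs n w), S (observation Xs n w) &
  c (observation Xs n w) = k]].
have Fcases k : F k = set0 \/ exists2 w, B (observation Xs n w) &
    F k = [set w' | observation Xs n w' = observation Xs n w].
  have [[w [Bw Sw cw]]|F0] := pselect (F k !=set0).
    right; exists w => //; apply/seteqP; split => w' /=.
      by move=> [_ Sw' cw']; apply: cI => //; rewrite cw cw'.
    by rewrite /F /= => ->.
  by left; apply/seteqP; split => w //= Fw; apply: F0; exists w.
have mF k : measurable (F k).
  by have [->//|[w _ ->]] := Fcases k; exact: measurable_observation_eq.
have tF : trivIset setT F.
  apply/trivIsetP => i j _ _ ij; apply/seteqP; split =>
    w // -[[_ _ ci] [_ _ cj]].
  by move: ij; rewrite -ci -cj eqxx.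
have PF k : (P t1 (F k) <= P t2 (F k))%E.
  have [->|[w Bw ->]] := Fcases k; first by rewrite !measure0.
  by rewrite -L1 -L2 lee_fin; exact: LB.
have mOB : measurable (observation Xs n @^-1` B).
  by rewrite -[X in measurable X]setTI; exact: measurable_observation.
have mUF : measurable (\bigcup_k F k) by exact: bigcup_measurable.
have null i : P t1 (Xs i @^-1` (~` C i)) = 0%E.
  rewrite preimage_setC probability_setC; last exact: measurable_funPTI.
  by rewrite (hC i).2 subee.
apply: (@le_trans _ _ (P t1 (\bigcup_k F k))).
  apply: (@le_trans _ _ (P t1 (\bigcup_k F k) +
      P t1 (\bigcup_i (Xs i @^-1` (~` C i))))%E).
    apply: (@le_trans _ _ (P t1 (\bigcup_k F k `|` \bigcup_i (Xs i @^-1` (~` C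
      i))))).
      apply: le_prob => //.
        apply: measurableU => //; apply: bigcup_measurable => i _.
        by apply: measurable_funPTI; exact: measurableC.
      move=> w /= Bw; have [Sw|] := pselect (S (observation Xs n w)).
        by left; exists (c (observation Xs n w)).
      move=> /existsNP[i Ci]; right; exists i => //= Ci'; apply: Ci.
      by rewrite tnth_mktuple.
    apply: measureU2 => //; apply: bigcup_measurable => i _.
    by apply: measurable_funPTI; exact: measurableC.
  rewrite [X in (_ + X)%E](_ : _ = 0%E) ?adde0//.
  apply/eqP; rewrite -measure_le0.
  apply: (le_trans (measure_sigma_subadditive _ _ _ (@subset_refl _ _))) => //.
  - by move=> i; apply: measurable_funPTI; exact: measurableC.
  - apply: bigcup_measurable => i _.
    by apply: measurable_funPTI; exact: measurableC.
  - by rewrite eseries0// => i _ _; exact: null.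
apply: (@le_trans _ _ (P t2 (\bigcup_k F k))); last first.
  by apply: le_prob => // w [k _ []].
rewrite !measure_bigcup//.
apply: lee_nneseries => [i *|i *]; [exact: measure_ge0|exact: PF].
Qed.

(* [ULE] constrains the likelihood only at points that are observations, so
   the points of [B] where the inequality fails are removed first. *)
Lemma pdf_comparison (n : nat) (L : R -> n.-tuple R -> R) (t1 t2 : R)
    (B : set (n.-tuple R)) :
  joint_pdf Theta P Xs L -> Theta t1 -> Theta t2 -> measurable B ->
  (forall w, B (observation Xs n w) ->
     L t1 (observation Xs n w) <= L t2 (observation Xs n w)) ->
  (P t1 (observation Xs n @^-1` B) <= P t2 (observation Xs n @^-1` B))%E.
Proof.
move=> [mu _ pdfL] T1 T2 mB LB.
have [L10 mL1 PL1] := pdfL t1 T1; have [L20 mL2 PL2] := pdfL t2 T2.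
pose B' := B `&` [set x | L t1 x <= L t2 x].
have mB' : measurable B' by apply: measurableI => //; exact: measurable_le_set.
have -> : observation Xs n @^-1` B = observation Xs n @^-1` B'.
  by apply/seteqP; split => w /= => [Bw|[]//]; split => //; exact: LB.
rewrite PL1// PL2//; apply: ge0_le_integral => //.
- by move=> x _; rewrite lee_fin.
- by apply/measurable_EFinP; exact: measurable_funS mL1.
- by apply/measurable_EFinP; exact: measurable_funS mL2.
- by move=> x [_ /=]; rewrite lee_fin.
Qed.

Lemma likelihood_comparison (L : forall n, R -> n.-tuple R -> R) (n : nat)
    (t1 t2 : R) (B : set (n.-tuple R)) :
  likelihood Theta P Xs L -> (0 < n)%N -> Theta t1 -> Theta t2 ->
  measurable B ->
  (forall w, B (observation Xs n w) ->
     L n t1 (observation Xs n w) <= L n t2 (observation Xs n w)) ->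
  (P t1 (observation Xs n @^-1` B) <= P t2 (observation Xs n @^-1` B))%E.
Proof.
by move=> [h|h] n0; [apply: pmf_comparison|apply: pdf_comparison]; exact: h.
Qed.

End likelihood_comparison.

(** * The multistage plan *)

Section stopping.
Context d (T : measurableType d).
Variables (s : nat) (D : nat -> T -> nat).

Lemma stopping_stage_first (l : nat) (w : T) : (1 <= l <= s)%N ->
  D l w != 0%N -> (forall k, (1 <= k < l)%N -> D k w = 0%N) ->
  stopping_stage s D w = l.
Proof.
move=> /andP[l1 ls] Dl Dk; rewrite /stopping_stage.
have -> : iota 1 s = iota 1 l.-1 ++ l :: iota l.+1 (s - l).
  have {1}-> : s = (l.-1 + (s - l).+1)%N by case: l l1 ls {Dl Dk} =>
    // l _ ls /=; rewrite subnSK// subnKC// ltnW.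
  by rewrite iotaD add1n prednK.
rewrite filter_cat (_ : [seq k <- iota 1 l.-1 | D k w != 0%N] = [::]) ?cat0s /=
  ?Dl//.
apply/eqP; rewrite -(negbK (_ == _)) -has_filter; apply/hasPn => k.
by rewrite mem_iota add1n prednK// => /Dk ->.
Qed.

Lemma stopping_stageP (w : T) : (0 < s)%N ->
  D (stopping_stage s D w) w != 0%N ->
  (1 <= stopping_stage s D w <= s)%N /\
  forall k, (1 <= k < stopping_stage s D w)%N -> D k w = 0%N.
Proof.
move=> s0 Dne.
have ex : exists l, (1 <= l <= s)%N && (D l w != 0%N).
  exists (stopping_stage s D w); rewrite Dne andbT /stopping_stage.
  (* For an empty list the default [s] is returned, itself a stage because s > 0. *)
  case E : [seq l <- iota 1 s | D l w != 0%N] => [|l r] /=;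
    first by rewrite s0 leqnn.
  have : l \in [seq l <- iota 1 s | D l w != 0%N] by rewrite E mem_head.
  by rewrite mem_filter mem_iota add1n ltnS => /andP[].
case: (ex_minnP ex) => l /andP[ls Dl] lmin.
have Dk k : (1 <= k < l)%N -> D k w = 0%N.
  move=> /andP[k1 kl]; apply/eqP/negP => /negP Dk.
  have /andP[_ ls'] := ls.
  by have := lmin k; rewrite k1 (leq_trans (ltnW kl) ls') Dk leqNgt kl =>
    /(_ isT).
by rewrite (stopping_stage_first ls Dl Dk).
Qed.

End stopping.

Section decision.
Context (R : realType).
Variables (m : nat) (f g : nat -> \bar R).
Implicit Types x : R.

Lemma decision_le (x : R) (i : nat) : (1 <= i < m)%N ->
  decision m f g x = i -> (x%:E <= f i)%E.
Proof.
move=> /andP[i1 im]; rewrite /decision; case: ifP => [xf <- //|_].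
case: pickP => [j /andP[_ /andP[_ xf]] <- //|_].
by case: ifP => [_ mi|_ i0]; [move: im; rewrite mi ltnn|move: i1; rewrite -i0].
Qed.

Lemma decision_gt (x : R) (i : nat) : (2 <= i)%N ->
  decision m f g x = i -> (g i.-1 < x%:E)%E.
Proof.
move=> i2; rewrite /decision; case: ifP => [_ i1|_]; first by rewrite -i1 in i2.
case: pickP => [j /andP[_ /andP[gx _]] <- //|_].
by case: ifP => [gx <- //|_ i0]; rewrite -i0 in i2.
Qed.

(** The decision depends on x only through the finitely many truth values collected in [b], so a
    level set is a finite union of level sets of [b]. *)
Lemma measurable_decision (i : nat) : measurable [set x :
  R | decision m f g x = i].
Proof.
pose b x : (bool * {ffun 'I_m -> bool} * bool)%type :=
  ((x%:E <= f 1%N)%E,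
   [ffun i : 'I_m => (2 <= i)%N && (g i.-1 < x%:E <= f i)%E],
   (g m.-1 < x%:E)%E).
pose h (v : bool * {ffun 'I_m -> bool} * bool) : nat :=
  if v.1.1 then 1%N
  else if [pick i : 'I_m | v.1.2 i] is Some i then nat_of_ord i
  else if v.2 then m else 0%N.
have dE x : decision m f g x = h (b x).
  rewrite /decision /h /=; congr (if _ then _ else _).
  rewrite (@eq_pick _ _ (fun i => [ffun i : 'I_m =>
    (2 <= i)%N && (g i.-1 < x%:E <= f i)%E] i))// => j.
  by rewrite ffunE.
have mle (e : \bar R) : measurable [set x : R | (x%:E <= e)%E].
  exact: (@measurable_lee_set _ _ _ (fun x : R => x)).
have mlt (e : \bar R) : measurable [set x : R | (e < x%:E)%E].
  exact: (@measurable_lte_set _ _ _ (fun x : R => x)).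
have meq (p : R -> bool) (v : bool) : measurable [set x | p x] ->
    measurable [set x | p x = v].
  move=> mp; case: v => //.
  rewrite (_ : [set x | _] = ~` [set x | p x]); first exact: measurableC.
  by apply/seteqP; split => x /=; [move=> ->|move=> /negP/negbTE].
rewrite (_ : [set x | _] =
    \bigcup_(v in [set v | h v = i]) [set x | b x = v]); last first.
  apply/seteqP; split => x /=; first by rewrite dE => hx; exists (b x).
  by move=> [v /= hv bx]; rewrite dE bx.
apply: fin_bigcup_measurable => [|[[v1 v2] v3] _]; first exact: finite_finset.
rewrite (_ : [set x | _] = [set x | (x%:E <= f 1%N)%E = v1] `&`
   \bigcap_(j in [set: 'I_m])
     [set x | (2 <= j)%N && (g j.-1 < x%:E <= f j)%E = v2 j] `&`
   [set x | (g m.-1 < x%:E)%E = v3]).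
  apply: measurableI; last by apply: meq; exact: mlt.
  apply: measurableI; first by apply: meq; exact: mle.
  apply: fin_bigcap_measurable => // j _; apply: meq.
  case: (2 <= j)%N => /=; last first.
    by rewrite (_ : [set x | _] = set0); last by apply/seteqP; split.
  rewrite (_ : [set x | _] = [set x | (g j.-1 < x%:E)%E] `&` [set x | (x%:E <=
    f j)%E]).
    by apply: measurableI; [exact: mlt|exact: mle].
  by apply/seteqP; split => x /= => [/andP|[-> ->]].
apply/seteqP; split => x /=.
  by move=> [<- <- <-]; split => //; split => // j _ /=; rewrite ffunE.
move=> [[e1 e2] e3]; rewrite /b e1 e3; congr (_, _, _).
by apply/ffunP => j; rewrite ffunE; exact: e2.
Qed.

End decision.

Section plan.
Context d (T : measurableType d) (R : realType).
Variables (Theta : set R) (P : R -> probability T R) (Xs :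
  nat -> {mfun T >-> R}).
Variables (L : forall n, R -> n.-tuple R -> R) (phi : forall n,
  n.-tuple R -> R).
Arguments L : clear implicits.
Arguments phi : clear implicits.
Hypothesis lik : likelihood Theta P Xs L.
Hypothesis mphi : forall n, (0 < n)%N -> measurable_fun setT (phi n).
Hypothesis ule : forall n, (0 < n)%N -> ULE Theta Xs L (phi n).

Variables (s : nat) (N : nat -> nat) (dec : nat -> R -> nat).
Hypothesis s_gt0 : (0 < s)%N.
Hypothesis N_gt0 : (0 < N 1)%N.
Hypothesis N_incr : forall l, (1 <= l < s)%N -> (N l < N l.+1)%N.
Hypothesis mdec : forall l j, measurable [set x : R | dec l x = j].

Let hat l w := phi (N l) (observation Xs (N l) w).
Let D l w := dec l (hat l w).
Let stop := stopping_stage s D.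

(** A common form for acceptance, rejection, joint rejection and their intersections with a
    constraint on the final estimate: [C] is indexed by the final decision and restricts the final
    estimate. *)
Definition plan_event (C : nat -> set R) : set T :=
  [set w | D (stop w) w != 0%N /\ C (D (stop w) w) (hat (stop w) w)].

Let stage_event (C : nat -> set R) l : set T :=
  [set w | [/\ forall k, (1 <= k < l)%N -> D k w = 0%N, D l w != 0%N &
     C (D l w) (hat l w)]].

Let N_le k l : (1 <= k <= l)%N -> (l <= s)%N -> (N k <= N l)%N.
Proof.
move=> /andP[k1]; elim: l => [|l IH]; first by rewrite leqn0 => /eqP ->.
rewrite leq_eqVlt ltnS => /predU1P[-> //|kl] ls.
apply: leq_trans (IH kl (ltnW ls)) _; apply: ltnW; apply: N_incr.
by rewrite ls (leq_trans k1 kl).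
Qed.

Let Nl_gt0 l : (1 <= l <= s)%N -> (0 < N l)%N.
Proof. by move=> /andP[l1 ls]; apply: (leq_trans N_gt0); apply: N_le. Qed.

Lemma plan_event_stages C :
  plan_event C = \bigcup_(l in [set l | (1 <= l <= s)%N]) stage_event C l.
Proof.
apply/seteqP; split => w /=.
  move=> [Dne Cw]; have [ls Dk] := stopping_stageP s_gt0 Dne.
  by exists (stop w) => //; split.
move=> [l /= ls [Dk Dl Cl]].
by rewrite /plan_event /= /stop (stopping_stage_first ls Dl Dk).
Qed.

(** Expresses earlier decisions through the observation of the current stage, so that a stage event
    is the preimage of a set of tuples. The default 0 never occurs there, since sample sizes
    increase. *)
Let prefix_tuple n (x : n.-tuple R) k : k.-tuple R := [tuple nth 0 x i | i < k].

Let measurable_prefix_tuple n k : measurable_fun setT (@prefix_tuple n ^~ k).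
Proof.
apply/measurable_fun_tnthP => i.
have [im|im] := ltnP i n; last first.
  rewrite (_ : _ \o _ = cst 0); first exact: measurable_cst.
  by apply/funext => x /=; rewrite tnth_mktuple nth_default// size_tuple.
rewrite (_ : _ \o _ = (@tnth _ R)^~ (Ordinal im)); first exact: measurable_tnth.
by apply/funext => x /=; rewrite tnth_mktuple (tnth_nth 0).
Qed.

Let prefix_observation n k w : (k <= n)%N ->
  prefix_tuple (observation Xs n w) k = observation Xs k w.
Proof.
move=> kn; apply: eq_from_tnth => i; rewrite !tnth_mktuple.
by rewrite -(tnth_nth 0 _ (widen_ord kn i)) tnth_mktuple.
Qed.

Section stage_event.
Variable C : nat -> set R.
Hypothesis mC : forall j, measurable (C j).

Let stage_tuples l : set ((N l).-tuple R) :=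
  (\bigcap_(k in [set k | (1 <= k < l)%N])
     [set x | dec k (phi (N k) (prefix_tuple x (N k))) = 0%N]) `&`
  phi (N l) @^-1` [set y | dec l y != 0%N /\ C (dec l y) y].

Let stage_eventE l : (1 <= l <= s)%N ->
  stage_event C l = observation Xs (N l) @^-1` @stage_tuples l.
Proof.
move=> /andP[l1 ls]; apply/seteqP; split => w /=.
  move=> [Dk Dl Cl]; split => // k /= kl.
  rewrite prefix_observation; first exact: Dk.
  by apply: N_le => //; case/andP: kl => -> /ltnW.
move=> [Dk [Dl Cl]]; split => // k kl.
have := Dk k kl; rewrite /= prefix_observation//.
by apply: N_le => //; case/andP: kl => -> /ltnW.
Qed.

Let measurable_stage_tuples l : (1 <= l <= s)%N -> measurable (@stage_tuples l).
Proof.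
move=> ls; apply: measurableI.
  apply: bigcap_measurableType => k /= kl.
  have k0 : (0 < N k)%N.
    by apply: Nl_gt0; case/andP: kl ls => -> /ltnW h /andP[_ /(leq_trans h) ->].
  rewrite -[X in measurable X]setTI.
  have := measurableT_comp (mphi k0) (@measurable_prefix_tuple (N l) (N k)).
  by move=> /(_ measurableT [set y | dec k y = 0%N]); apply; exact: mdec.
rewrite -[X in measurable X]setTI; apply: mphi => //; first exact: Nl_gt0.
(* The set to be tested varies with the decision; splitting along its nonzero values fixes it. *)
rewrite (_ : [set y | _] = \bigcup_j ([set y | dec l y = j.+1] `&` C j.+1)).
  by apply: bigcup_measurable => j _; apply: measurableI.
apply/seteqP; split => y /=.
  by move=> [d0 Cy]; exists (dec l y).-1 => //=; rewrite prednK// lt0n.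
by move=> [j _ [/= -> Cy]].
Qed.

Let measurable_stage_event l : (1 <= l <= s)%N -> measurable (stage_event C l).
Proof.
move=> ls; rewrite stage_eventE// -[X in measurable X]setTI.
by apply: measurable_observation => //; exact: measurable_stage_tuples.
Qed.

Lemma measurable_plan_event : measurable (plan_event C).
Proof.
by rewrite plan_event_stages; apply: bigcup_measurable => l; exact:
  measurable_stage_event.
Qed.

Let plan_event_sum t :
  (P t (plan_event C) = \sum_(1 <= l < s.+1) P t (stage_event C l))%E.
Proof.
(* Stages shifted to start at 0; disjointness is the uniqueness of the first stage with a nonzero
   decision. *)
pose F i := if (i < s)%N then stage_event C i.+1 else set0.
have mF i : measurable (F i).
  by rewrite /F; case: ifP => // si; exact: measurable_stage_event.
have tF : trivIset setT F.
  apply/trivIsetP => i j _ _ ij; apply/seteqP; split => w // -[].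
  rewrite /F; case: ifP => // si; case: ifP => // sj [Di Di0 _] [Dj Dj0 _].
  have ei := @stopping_stage_first _ T s D i.+1 w si Di0 Di.
  have ej := @stopping_stage_first _ T s D j.+1 w sj Dj0 Dj.
  by move: ej; rewrite ei => -[eij]; rewrite eij eqxx in ij.
have -> : plan_event C = \big[setU/set0]_(i < s) F i.
  rewrite plan_event_stages -bigcup_mkord; apply/seteqP; split => w.
    by move=> [[//|l] /= ls Cl]; exists l => //; rewrite /F ls.
  by move=> [l /= ls]; rewrite /F ls => Cl; exists l.+1.
rewrite measure_bigsetU// big_add1 /= big_mkord.
by apply: eq_bigr => i _; rewrite /F ltn_ord.
Qed.

Lemma le_plan_event (E : nat -> set T) t :
  (forall l, (1 <= l <= s)%N -> measurable (E l)) ->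
  (forall l w, (1 <= l <= s)%N -> D l w != 0%N -> C (D l w) (hat l w) -> E l w)
    ->
  (P t (plan_event C) <= \sum_(1 <= l < s.+1) P t (E l))%E.
Proof.
move=> mE CE; rewrite plan_event_sum big_nat [leRHS]big_nat.
apply: lee_sum => l; rewrite ltnS => ls; apply: le_prob.
- exact: measurable_stage_event.
- exact: mE.
- by move=> w [_ Dl Cl]; exact: CE.
Qed.

Lemma le_plan_event_max (E : nat -> set T) t (e : R) :
  (forall l, (1 <= l <= s)%N -> measurable (E l)) ->
  (forall l w, (1 <= l <= s)%N -> D l w != 0%N -> C (D l w) (hat l w) -> E l w)
    ->
  (forall l, (1 <= l <= s)%N -> (P t (E l) <= e%:E)%E) ->
  (P t (plan_event C) <= (s%:R * e)%:E)%E.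
Proof.
move=> mE CE Ee; apply: (le_trans (le_plan_event t mE CE)).
apply: (@le_trans _ _ (\sum_(1 <= l < s.+1) e%:E)%E).
  rewrite big_nat [leRHS]big_nat; apply: lee_sum => l; rewrite ltnS.
  exact: Ee.
by rewrite sumEFin sumr_const_nat subn1 /= mulr_natl.
Qed.

(** With the estimate at or above the larger parameter, both parameters lie on the rising branch of
    the likelihood. *)
Lemma plan_event_nondecreasing t1 t2 : Theta t1 -> Theta t2 -> t1 <= t2 ->
  (forall l w, (1 <= l <= s)%N -> D l w != 0%N -> C (D l w) (hat l w) ->
     t2 <= hat l w) ->
  (P t1 (plan_event C) <= P t2 (plan_event C))%E.
Proof.
move=> T1 T2 t12 Chat; rewrite !plan_event_sum big_nat [leRHS]big_nat.
apply: lee_sum => l; rewrite ltnS => ls; rewrite stage_eventE//.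
apply: (likelihood_comparison lik) => //; first exact: Nl_gt0.
  exact: measurable_stage_tuples.
move=> w; rewrite -[X in X -> _]/((observation Xs (N l) @^-1` @stage_tuples l)
  w).
rewrite -stage_eventE// => -[_ Dl Cl].
by apply: (ule (Nl_gt0 ls) w).1 => //; exact: Chat.
Qed.

Lemma plan_event_nonincreasing t1 t2 : Theta t1 -> Theta t2 -> t1 <= t2 ->
  (forall l w, (1 <= l <= s)%N -> D l w != 0%N -> C (D l w) (hat l w) ->
     hat l w <= t1) ->
  (P t2 (plan_event C) <= P t1 (plan_event C))%E.
Proof.
move=> T1 T2 t12 Chat; rewrite !plan_event_sum big_nat [leRHS]big_nat.
apply: lee_sum => l; rewrite ltnS => ls; rewrite stage_eventE//.
apply: (likelihood_comparison lik) => //; first exact: Nl_gt0.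
  exact: measurable_stage_tuples.
move=> w; rewrite -[X in X -> _]/((observation Xs (N l) @^-1` @stage_tuples l)
  w).
rewrite -stage_eventE// => -[_ Dl Cl].
by apply: (ule (Nl_gt0 ls) w).2 => //; exact: Chat.
Qed.

End stage_event.

End plan.

(** * Error probabilities at a single stage *)

Section stage_errors.
Context d (T : measurableType d) (R : realType).
Variables (Theta : set R) (P : R -> probability T R) (Xs :
  nat -> {mfun T >-> R}).
Variables (L : forall n, R -> n.-tuple R -> R) (phi : forall n,
  n.-tuple R -> R).
Arguments L : clear implicits.
Arguments phi : clear implicits.
Hypothesis lik : likelihood Theta P Xs L.
Hypothesis mphi : forall n, (0 < n)%N -> measurable_fun setT (phi n).
Hypothesis ule : forall n, (0 < n)%N -> ULE Theta Xs L (phi n).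

Let phi_ n w := phi n (observation Xs n w).
Hypothesis attained : forall n, (0 < n)%N -> extrema_attained Theta P (phi_ n).

Lemma measurable_estimator n : (0 < n)%N -> measurable_fun setT (phi_ n).
Proof.
by move=> n0; apply: (measurableT_comp (mphi n0)); exact:
  measurable_observation.
Qed.

(** Since f_under <= f <= t2 <= t, the estimate is below both parameters on the event, where the
    likelihood falls. The end [t2] of the indifference zone is thus the worst case. *)
Lemma lower_error_mono n t t1 t2 a b : (0 < n)%N -> Theta t -> Theta t2 ->
  t2 <= t ->
  (P t [set w | ((phi_ n w)%:E <= f_under Theta P (phi_ n) t1 t2 a b)%E]
   <= P t2 [set w | ((phi_ n w)%:E <= f_under Theta P (phi_ n) t1 t2 a b)%E])%E.
Proof.
move=> n0 Tt T2 t2t.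
pose x := f_under Theta P (phi_ n) t1 t2 a b.
have xt2 : (x <= t2%:E)%E.
  by apply: (le_trans (f_under_le _ _ _ _ _ _ _)); exact: f_le.
apply: (@likelihood_comparison _ _ _ _ _ _ _ _ _ _ [set y | ((phi n y)%:E <=
  x)%E] lik) => //.
  by apply: measurable_lee_set; exact: mphi.
move=> w /= wx; apply: (ule n0 w).2 => //.
by rewrite -lee_fin (le_trans wx).
Qed.

Lemma upper_error_mono n t t1 t2 a b : (0 < n)%N -> Theta t -> Theta t1 ->
  t <= t1 ->
  (P t [set w | (g_over Theta P (phi_ n) t1 t2 a b < (phi_ n w)%:E)%E]
   <= P t1 [set w | (g_over Theta P (phi_ n) t1 t2 a b < (phi_ n w)%:E)%E])%E.
Proof.
move=> n0 Tt T1 tt1.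
pose x := g_over Theta P (phi_ n) t1 t2 a b.
have xt1 : (t1%:E <= x)%E.
  by apply: le_trans (g_over_ge _ _ _ _ _ _ _); exact: g_ge.
apply: (@likelihood_comparison _ _ _ _ _ _ _ _ _ _ [set y | (x < (phi n
  y)%:E)%E] lik) => //.
  by apply: measurable_lte_set; exact: mphi.
move=> w /= wx; apply: (ule n0 w).1 => //.
by rewrite -lee_fin (le_trans xt1)// ltW.
Qed.

Lemma lower_error_le n t t1 t2 a b : (0 < n)%N -> Theta t -> Theta t2 ->
  t2 <= t -> 0 < b < 1 ->
  (P t [set w | ((phi_ n w)%:E <= f_under Theta P (phi_ n) t1 t2 a b)%E]
   <= b%:E)%E.
Proof.
move=> n0 Tt T2 t2t b01; apply:
  (le_trans (lower_error_mono _ _ _ n0 Tt T2 t2t)).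
have mZ := measurable_estimator n0.
apply: le_trans (prob_le_f (attained n0) T2 b01); apply: le_prob.
- exact: measurable_lee_set.
- exact: measurable_lee_set.
- by move=> w /= h; apply: (le_trans h); exact: f_under_le.
Qed.

Lemma upper_error_le n t t1 t2 a b : (0 < n)%N -> Theta t -> Theta t1 ->
  t <= t1 -> 0 < a < 1 ->
  (P t [set w | (g_over Theta P (phi_ n) t1 t2 a b < (phi_ n w)%:E)%E]
   <= a%:E)%E.
Proof.
move=> n0 Tt T1 tt1 a01; apply:
  (le_trans (upper_error_mono _ _ _ n0 Tt T1 tt1)).
have mZ := measurable_estimator n0.
apply: le_trans (prob_ge_g mZ (attained n0) T1 a01); apply: le_prob.
- exact: measurable_lte_set.
- exact: measurable_lte_set.
- by move=> w /=; apply: le_lt_trans; exact: g_over_ge.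
Qed.

End stage_errors.

(** Serves the bounds that allow one risk per side and stage instead of a sum over the
    hypotheses. *)
Lemma chain_union (T : Type) (A : nat -> set T) (r : seq nat) :
  (forall j k, A j `<=` A k \/ A k `<=` A j) ->
  [set w | exists2 k, k \in r & A k w] = set0 \/
  exists2 k, k \in r & [set w | exists2 k, k \in r & A k w] = A k.
Proof.
move=> chain; elim: r => [|j r [IH|[k kr IH]]].
- by left; apply/seteqP; split => w // -[].
- right; exists j; first exact: mem_head.
  apply/seteqP; split => w /=; last by move=> ?; exists j; rewrite ?mem_head.
  move=> [k]; rewrite inE => /predU1P[-> //|kr Aw].
  suff : set0 w by [].
  by rewrite -IH; exists k.
- right; have rE w : (exists2 k, k \in r & A k w) -> A k w by rewrite -IH.
  have [jk|kj] := chain j k.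
    exists k; first by rewrite inE kr orbT.
    apply/seteqP; split => w /=; last by move=> ?; exists k => //;
      rewrite inE kr orbT.
    move=> [i]; rewrite inE => /predU1P[-> /jk //|ir Aw].
    by apply: rE; exists i.
  exists j; first exact: mem_head.
  apply/seteqP; split => w /=; last by move=> ?; exists j => //; exact:
    mem_head.
  move=> [i]; rewrite inE => /predU1P[-> //|ir Aw].
  by apply: kj; apply: rE; exists i.
Qed.


Lemma measurable_prop d (U : measurableType d) (A : Prop) :
  measurable [set _ : U | A].
Proof.
have [hA|hA] := pselect A.
  by rewrite (_ : [set _ | _] = setT)//; apply/seteqP; split.
by rewrite (_ : [set _ | _] = set0)//; apply/seteqP; split.
Qed.

(** Serves (VI), where the largest set of the chain could change with the stage and with zeta, while
    a factor of order m is harmless. *)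
Lemma prob_union_le d (T : measurableType d) (R : realType)
    (Q : probability T R) (A : nat -> set T) (r : seq nat) :
  (forall k, k \in r -> measurable (A k)) ->
  measurable [set w | exists2 k, k \in r & A k w] /\
  (Q [set w | exists2 k, k \in r & A k w] <= \sum_(k <- r) Q (A k))%E.
Proof.
elim: r => [|j r IH] mA.
  rewrite (_ : [set w | _] = set0); last by apply/seteqP; split => w // -[].
  by rewrite measure0 big_nil.
have [|mr Qr] := IH; first by move=> k kr; apply: mA; rewrite inE kr orbT.
have mj : measurable (A j) by apply: mA; exact: mem_head.
have -> : [set w | exists2 k, k \in j :: r & A k w] =
    A j `|` [set w | exists2 k, k \in r & A k w].
  apply/seteqP; split => w /=.
    move=> [k]; rewrite inE => /predU1P[->|kr Aw]; [by left|by right; exists k].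
  move=> [Aw|[k kr Aw]]; first by exists j => //; exact: mem_head.
  by exists k => //; rewrite inE kr orbT.
split; first exact: measurableU.
rewrite big_cons; apply: (@le_trans _ _ (Q (A j) +
  Q [set w | exists2 k, k \in r & A k w])%E); first exact: measureU2.
exact: leeD.
Qed.

Theorem theorem2
  (R : realType) (d : measure_display) (T : measurableType d)
  (* model *)
  (Theta : set R) (P : R -> probability T R)
  (X : {mfun T >-> R}) (Xs : nat -> {mfun T >-> R})
  (L : forall n : nat, R -> n.-tuple R -> R)
  (* hypotheses to be tested and indifference zones *)
  (m : nat) (th : nat -> \bar R) (th' th'' : nat -> R)
  (* estimators, sampling plan and risks, the latter two depending on zeta *)
  (phi : forall n : nat, n.-tuple R -> R)
  (s : R -> nat) (ns : R -> nat -> nat) (alpha beta : nat -> R -> R) :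
  (2 <= m)%N ->
  identical_samples Theta P X Xs ->
  likelihood Theta P Xs L ->
  th 0%N = -oo%E -> th m = +oo%E ->
  (forall i, (i < m)%N -> (th i < th i.+1)%E) ->
  (forall i, (1 <= i <= m.-1)%N ->
     [/\ Theta (th' i), Theta (th'' i), ((th' i)%:E < th i)%E &
         (th i < (th'' i)%:E)%E]) ->
  (forall i, (1 <= i <= m.-2)%N -> th'' i <= th' i.+1) ->
  (forall n, (0 < n)%N -> measurable_fun setT (phi n)) ->
  let phi_ n (w : T) := phi n (observation Xs n w) in
  ULCE Theta P Xs L phi ->
  (forall n, (0 < n)%N -> extrema_attained Theta P (phi_ n)) ->
  (forall i, (1 <= i <= m.-1)%N ->
     order_zeta (alpha i) /\ order_zeta (beta i)) ->
  (forall i z, (1 <= i <= m.-1)%N -> 0 < z ->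
     0 < alpha i z < 1 /\ 0 < beta i z < 1) ->
  (forall z, 0 < z -> alpha m z = 0 /\ beta 0%N z = 0) ->
  (forall z, 0 < z ->
     [/\ (0 < s z)%N, (0 < ns z 1)%N &
         forall l, (1 <= l < s z)%N -> (ns z l < ns z l.+1)%N]) ->
  let crossing z n := (0 < n)%N /\
    forall i, (1 <= i <= m.-1)%N ->
      (g_ Theta P (phi_ n) (th' i) (alpha i z)
       <= f_ Theta P (phi_ n) (th'' i) (beta i z))%E in
  (forall z, 0 < z -> exists n,
     [/\ crossing z n, (forall k, crossing z k -> (n <= k)%N) &
         (n <= ns z (s z))%N]) ->
  let hat z l := phi_ (ns z l) in
  let fl z l i :=
    f_under Theta P (hat z l) (th' i) (th'' i) (alpha i z) (beta i z) in
  let gl z l i :=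
    g_over Theta P (hat z l) (th' i) (th'' i) (alpha i z) (beta i z) in
  let D z l w := decision m (fl z l) (gl z l) (hat z l w) in
  (forall z t, 0 < z -> Theta t -> P t [set w | D z (s z) w = 0%N] = 0%E) ->
  let alphabar i z := \big[Num.max/0]_(i.+1 <= j < m.+1) alpha j z in
  let betabar i z := \big[Num.max/0]_(0 <= j < i.+1) beta j z in
  let Rset := reduced_set m Theta th th' th'' in
  let Acc z i := accept (s z) (D z) i in
  let Rej z i := reject m (s z) (D z) i in
  let thetahat z w := hat z (stopping_stage (s z) (D z) w) w in
  (forall z, 0 < z ->
     (* I *)
     (forall t1 t2, Rset 0%N t1 -> Rset 0%N t2 -> t1 <= t2 ->
        (P t1 (Rej z 0%N) <= P t2 (Rej z 0%N))%E) /\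
     (* II *)
     (forall t1 t2, Rset m.-1 t1 -> Rset m.-1 t2 -> t1 <= t2 ->
        (P t2 (Rej z m.-1) <= P t1 (Rej z m.-1))%E) /\
     (* III *)
     (forall i t, (i <= m.-1)%N -> Rset i t ->
        (P t (Rej z i) <= ((s z)%:R * (alphabar i z + betabar i z))%:E)%E) /\
     (* IV *)
     (forall i, (0 < i <= m.-1)%N ->
        (forall t, Theta t -> t <= th' i ->
           (P t (Acc z i) <= ((s z)%:R * alpha i z)%:E)%E) /\
        (forall t1 t2, Theta t1 -> Theta t2 -> t1 <= t2 -> t2 <= th' i ->
           (P t1 (Acc z i) <= P t2 (Acc z i))%E)) /\
     (* V *)
     (forall i, (i <= m.-2)%N ->
        (forall t, Theta t -> th'' i.+1 <= t ->
           (P t (Acc z i) <= ((s z)%:R * beta i.+1 z)%:E)%E) /\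
        (forall t1 t2, Theta t1 -> Theta t2 -> th'' i.+1 <= t1 -> t1 <= t2 ->
           (P t2 (Acc z i) <= P t1 (Acc z i))%E))) /\
  (* VI *)
  ((forall t, Theta t -> mutually_independent (P t) Xs) ->
   (forall t rho, Theta t ->
      (P t).-integrable setT (fun w => (expR (rho * X w))%:E)) ->
   (forall n (x : n.-tuple R), (0 < n)%N ->
      phi n x = n%:R^-1 * \sum_(i < n) tnth x i) ->
   (forall n t, (0 < n)%N -> Theta t -> ('E_(P t)[phi_ n])%E = t%:E) ->
   (forall n, (0 < n)%N -> ULE Theta Xs L (phi n)) ->
   forall i t, (i <= m.-1)%N -> Rset i t ->
     P t (Rej z i) @[z --> 0^'+] --> 0%E) /\
  ((3 <= m)%N -> forall z, 0 < z ->
     (* VII *)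
     (forall i t a b, (1 <= i <= m.-2)%N -> `[a, b] `<=` Rset i ->
        a <= t <= b ->
        (P t (Rej z i)
         <= P a (Rej z i `&` [set w | (thetahat z w <= a)%R])
            + P b (Rej z i `&` [set w | (b <= thetahat z w)%R]))%E /\
        (a < b ->
         (P b (Rej z i `&` [set w | (thetahat z w <= a)%R])
            + P a (Rej z i `&` [set w | (b <= thetahat z w)%R])
          <= P t (Rej z i))%E)) /\
     (* VIII *)
     (forall t1 t2, Rset 0%N t1 -> Rset 0%N t2 -> t1 <= t2 ->
        (P t1 (Rej z 0%N `&` Rej z m.-1)
         <= P t2 (Rej z 0%N `&` Rej z m.-1))%E) /\
     (forall t1 t2, Rset m.-1 t1 -> Rset m.-1 t2 -> t1 <= t2 ->
        (P t2 (Rej z 0%N `&` Rej z m.-1)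
         <= P t1 (Rej z 0%N `&` Rej z m.-1))%E) /\
     (* IX *)
     (forall t, Rset 0%N t ->
        (P t (Rej z 0%N `&` Rej z m.-1)
         <= ((s z)%:R * \big[Num.max/0]_(1 <= i < m.-1) alpha i z)%:E)%E) /\
     (forall t, Rset m.-1 t ->
        (P t (Rej z 0%N `&` Rej z m.-1)
         <= ((s z)%:R * \big[Num.max/0]_(2 <= i < m) beta i z)%:E)%E)).

Proof.
move=> m2 same_law lik th0 thm th_incr th_sep th_sep2 mphi phi_ ulce attained
  ozeta ab01 ab0 hplan crossing cross hat fl gl D closed alphabar betabar Rset
  Acc Rej thetahat.
have ule := ulce.1.
have m0 : (0 < m)%N by exact: ltnW.
have im1 i : (i <= m.-1)%N = (i < m)%N by rewrite -ltnS prednK.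
have Tth i : (1 <= i < m)%N -> [/\ Theta (th' i),
  Theta (th'' i) & th' i < th'' i].
  rewrite -im1 => /th_sep[? ? h1 h2]; split => //.
  by rewrite -lte_fin (lt_trans h1).
have th_next i : (1 <= i)%N -> (i.+1 < m)%N -> th'' i <= th' i.+1.
  move=> i1 im; apply: th_sep2; rewrite i1 /=.
  by move: im; case: (m) => // -[].
have th'_mono i j : (1 <= i)%N -> (i <= j)%N -> (j < m)%N -> th' i <= th' j.
  move=> i1; elim: j => [|j IH]; first by rewrite leqn0 => /eqP i0;
    rewrite i0 in i1.
  rewrite leq_eqVlt ltnS => /predU1P[-> //|ij] jm.
  have j1 := leq_trans i1 ij.
  apply: (le_trans (IH ij (ltnW jm))); apply: le_trans (th_next j j1 jm).
  by have [|_ _ /ltW //] := Tth j; rewrite j1 ltnW.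
have th''_mono i j : (1 <= i)%N -> (i <= j)%N -> (j < m)%N -> th'' i <= th'' j.
  move=> i1; elim: j => [|j IH]; first by rewrite leqn0 => /eqP i0;
    rewrite i0 in i1.
  rewrite leq_eqVlt ltnS => /predU1P[-> //|ij] jm.
  have j1 := leq_trans i1 ij.
  apply: (le_trans (IH ij (ltnW jm))); apply: (le_trans (th_next j j1 jm)).
  by have [|_ _ /ltW //] := Tth j.+1; rewrite jm.
have Rset_Theta i t : Rset i t -> Theta t by move=> [[]].
have Rset_ge i t : (1 <= i)%N -> Rset i t -> th'' i <= t.
  by move=> i1 [_ + _]; rewrite gtn_eqF// lee_fin.
have Rset_le i t : (i.+1 < m)%N -> Rset i t -> t <= th' i.+1.
  by move=> im [_ _]; rewrite ltn_eqF// lee_fin.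
pose dec z l := decision m (fl z l) (gl z l).
have mdec z l j : measurable [set x | dec z l x = j] by exact:
  measurable_decision.
pose PE z C := plan_event Xs phi (s z) (ns z) (dec z) C.
pose stop z := stopping_stage (s z) (D z).
have PEw z C w : PE z C w = (D z (stop z w) w != 0%N /\
    C (D z (stop z w) w) (hat z (stop z w) w)) by [].
have Accw z i w : Acc z i w = (D z (stop z w) w = i.+1) by [].
have Rejw z i w : Rej z i w =
    exists j, [/\ (j < m)%N, j <> i & D z (stop z w) w = j.+1] by [].
have AccE z i : Acc z i = PE z (fun k => [set _ | k = i.+1]).
  apply/seteqP; split => w; rewrite PEw Accw; last by case.
  by move=> ->.
(* Decision k accepts H_(k-1), whence the shift; k <> 0 is part of [plan_event]. *)
have RejE z i : Rej z i = PE z (fun k => [set _ | (k <= m)%N /\ k <> i.+1]).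
  apply/seteqP; split => w; rewrite PEw Rejw.
    by move=> [j [jm ji ->]]; split => //; split => // -[].
  move=> [Dne [Dm Di]]; exists (D z (stop z w) w).-1.
  have D1 : (D z (stop z w) w).-1.+1 = D z (stop z w) w by rewrite prednK//
    lt0n.
  by split; rewrite ?D1// => e; apply: Di; rewrite -e D1.
have Rej2E z : Rej z 0%N `&` Rej z m.-1 =
    PE z (fun k => [set _ | (k <= m)%N /\ (k <> 1%N /\ k <> m)]).
  rewrite !RejE; apply/seteqP; split => w; rewrite /setI /= !PEw /= prednK//.
    by move=> [[? [? ?]] [_ [_]]].
  by move=> [? [? [? ?]]].
have D_lower z l w i : (1 <= i < m)%N -> D z l w = i ->
    ((hat z l w)%:E <= fl z l i)%E by exact: decision_le.
have D_upper z l w i : (2 <= i)%N -> D z l w = i ->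
    (gl z l i.-1 < (hat z l w)%:E)%E by exact: decision_gt.
have fl_le z l i : (fl z l i <= (th'' i)%:E)%E.
  by apply: (le_trans (f_under_le _ _ _ _ _ _ _)); exact: f_le.
have gl_ge z l i : ((th' i)%:E <= gl z l i)%E.
  by apply: le_trans (g_over_ge _ _ _ _ _ _ _); exact: g_ge.
have hat_le z l w i t : (1 <= i < m)%N -> D z l w = i -> th'' i <= t -> hat z l
  w <= t.
  move=> im Di it; rewrite -lee_fin (le_trans (D_lower z l w i im Di))//.
  by rewrite (le_trans (fl_le _ _ _))// lee_fin.
have hat_ge z l w i t : (2 <= i)%N -> D z l w = i -> t <= th' i.-1 -> t <= hat
  z l w.
  move=> i2 Di it; rewrite -lee_fin; apply:
    le_trans (ltW (D_upper z l w i i2 Di)).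
  by apply: le_trans (gl_ge _ _ _); rewrite lee_fin.
have Nl0 z l : 0 < z -> (1 <= l <= s z)%N -> (0 < ns z l)%N.
  move=> z0; have [s0 N1 Ninc] := hplan z z0.
  case: l => // l; elim: l => // l IH /andP[_ ls].
  by apply: leq_ltn_trans (Ninc l.+1 ls).
have mhat z l : 0 < z -> (1 <= l <= s z)%N -> measurable_fun setT (hat z l).
  by move=> z0 ls; apply: measurable_estimator => //; exact: Nl0.
have low z l t e (r : seq nat) :
  0 < z -> (1 <= l <= s z)%N -> Theta t -> 0 <= e ->
    (forall k, k \in r -> [/\ (1 <= k < m)%N, th'' k <= t & beta k z <= e]) ->
    let E := [set w | exists2 k, k \in r & ((hat z l w)%:E <= fl z l k)%E] in
    measurable E /\ (P t E <= e%:E)%E.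
  move=> z0 ls Tt e0 hr E.
  have mA k : measurable [set w | ((hat z l w)%:E <= fl z l k)%E].
    by apply: measurable_lee_set; exact: mhat.
  rewrite /E; have [|->|[k kr ->]] :=
    @chain_union T (fun k => [set w | ((hat z l w)%:E <= fl z l k)%E]) r.
  - move=> j k; have [jk|/ltW kj] := leP (fl z l j) (fl z l k).
      by left => w /= h; exact: le_trans jk.
    by right => w /= h; exact: le_trans kj.
  - by rewrite measure0 lee_fin.
  - split=> //; have [km kt kb] := hr k kr; have [_ Tk _] := Tth k km.
    apply: (@le_trans _ _ (beta k z)%:E); last by rewrite lee_fin.
    apply: (lower_error_le lik mphi ule attained) => //; first exact: Nl0.
    by have [] := ab01 k z; rewrite ?im1.
have high z l t e (r : seq nat) :
  0 < z -> (1 <= l <= s z)%N -> Theta t -> 0 <= e ->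
    (forall k, k \in r -> [/\ (1 <= k < m)%N, t <= th' k & alpha k z <= e]) ->
    let E := [set w | exists2 k, k \in r & (gl z l k < (hat z l w)%:E)%E] in
    measurable E /\ (P t E <= e%:E)%E.
  move=> z0 ls Tt e0 hr E.
  have mA k : measurable [set w | (gl z l k < (hat z l w)%:E)%E].
    by apply: measurable_lte_set; exact: mhat.
  rewrite /E; have [|->|[k kr ->]] :=
    @chain_union T (fun k => [set w | (gl z l k < (hat z l w)%:E)%E]) r.
  - move=> j k; have [jk|/ltW kj] := leP (gl z l j) (gl z l k).
      by right => w /=; exact: le_lt_trans.
    by left => w /=; exact: le_lt_trans.
  - by rewrite measure0 lee_fin.
  - split=> //; have [km kt kb] := hr k kr; have [Tk _ _] := Tth k km.
    apply: (@le_trans _ _ (alpha k z)%:E); last by rewrite lee_fin.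
    apply: (upper_error_le lik mphi ule attained) => //; first exact: Nl0.
    by have [] := ab01 k z; rewrite ?im1.
have bmax (F : nat -> R) i j k : (i <= k < j)%N ->
    F k <= \big[Num.max/0]_(i <= k < j) F k.
  by move=> ikj; apply: le_bigmax_seq => //; rewrite mem_index_iota.
have bmax0 (F : nat -> R) i j : 0 <= \big[Num.max/0]_(i <= k < j) F k.
  exact: bigmax_ge_id.
have PE_up z C t1 t2 : 0 < z -> (forall k, measurable (C k)) ->
    Theta t1 -> Theta t2 -> t1 <= t2 ->
    (forall l w, D z l w != 0%N -> C (D z l w) (hat z l w) -> t2 <= hat z l w)
      ->
    (P t1 (PE z C) <= P t2 (PE z C))%E.
  move=> z0 mC T1 T2 t12 Ct; have [s0 N1 Ninc] := hplan z z0.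
  apply: (plan_event_nondecreasing lik mphi ule s0 N1 Ninc (mdec z) mC T1 T2
    t12).
  by move=> l w _; exact: Ct.
have PE_down z C t1 t2 : 0 < z -> (forall k, measurable (C k)) ->
    Theta t1 -> Theta t2 -> t1 <= t2 ->
    (forall l w, D z l w != 0%N -> C (D z l w) (hat z l w) -> hat z l w <= t1)
      ->
    (P t2 (PE z C) <= P t1 (PE z C))%E.
  move=> z0 mC T1 T2 t12 Ct; have [s0 N1 Ninc] := hplan z z0.
  apply: (plan_event_nonincreasing lik mphi ule s0 N1 Ninc (mdec z) mC T1 T2
    t12).
  by move=> l w _; exact: Ct.
have PE_sum z C E t : 0 < z -> (forall k, measurable (C k)) ->
    (forall l, (1 <= l <= s z)%N -> measurable (E l)) ->
    (forall l w, D z l w != 0%N -> C (D z l w) (hat z l w) -> E l w) ->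
    (P t (PE z C) <= \sum_(1 <= l < (s z).+1) P t (E l))%E.
  move=> z0 mC mE CE; have [s0 N1 Ninc] := hplan z z0.
  apply: (le_plan_event P mphi s0 N1 Ninc (mdec z) mC t mE).
  by move=> l w _; exact: CE.
have PE_max z C E t e : 0 < z -> (forall k, measurable (C k)) ->
    (forall l w, D z l w != 0%N -> C (D z l w) (hat z l w) -> E l w) ->
    (forall l, (1 <= l <= s z)%N -> measurable (E l) /\ (P t (E l) <= e%:E)%E)
      ->
    (P t (PE z C) <= ((s z)%:R * e)%:E)%E.
  move=> z0 mC CE Ee; have [s0 N1 Ninc] := hplan z z0.
  apply: (le_plan_event_max mphi s0 N1 Ninc (mdec z) mC).
  - by move=> l ls; exact: (Ee l ls).1.
  - by move=> l w _; exact: CE.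
  - by move=> l ls; exact: (Ee l ls).2.
pose low_set z l i := [set w | exists2 k, k \in iota 1 i &
  ((hat z l w)%:E <= fl z l k)%E].
pose high_set z l i := [set w | exists2 k, k \in index_iota i.+1 m &
  (gl z l k < (hat z l w)%:E)%E].
(* A wrong decision k <= i puts the estimate below f_k; a wrong k >= i + 2 puts it above g_(k-1),
   with k - 1 >= i + 1. *)
have Rej_sub z l w i : (i < m)%N -> D z l w != 0%N ->
    (D z l w <= m)%N /\ D z l w <> i.+1 ->
    (low_set z l i `|` high_set z l i) w.
  move=> im Dne [Dm Di]; have [Dle|Dgt] := leqP (D z l w) i.
    left; exists (D z l w); first by rewrite mem_iota add1n ltnS lt0n Dne.
    by apply: D_lower => //; rewrite lt0n Dne/= (leq_ltn_trans Dle).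
  have Dgt2 : (i.+2 <= D z l w)%N by rewrite ltn_neqAle eq_sym Dgt andbT;
    apply/eqP.
  have D1 : (D z l w).-1.+1 = D z l w by rewrite prednK// lt0n.
  right; exists (D z l w).-1.
    by rewrite mem_index_iota; apply/andP; split; rewrite -ltnS D1.
  by apply: D_upper => //; exact: leq_trans Dgt2.
have mRej i k : measurable ([set _ : R | (k <= m)%N /\ k <> i]) by exact:
  measurable_prop.
have mRej2 k : measurable ([set _ : R | (k <= m)%N /\ (k <> 1%N /\ k <> m)]).
  exact: measurable_prop.
have mAcc i k : measurable ([set _ : R | k = i :> nat]) by exact:
  measurable_prop.
split.
  move=> z z0; have [az bz] := ab0 z z0.
  have pos k : (1 <= k < m)%N -> 0 < alpha k z /\ 0 < beta k z.
    move=> km; have [|/andP[? _] /andP[? _]] := ab01 k z _ z0; last by [].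
    by rewrite im1.
  split.
    (* (I): a decision k >= 2 has estimate > g_(k-1) >= th'_(k-1) >= th'_1 >= t2. *)
    move=> t1 t2 R1 R2 t12; rewrite RejE.
    apply: PE_up => //; [exact: Rset_Theta R1|exact: Rset_Theta R2|].
    move=> l w Dne [Dm D1]; have D2 : (2 <= D z l w)%N.
      by rewrite ltn_neqAle lt0n Dne andbT eq_sym; apply/eqP.
    apply: (hat_ge z l w _ t2 D2 erefl).
    apply: (le_trans (Rset_le 0%N t2 m2 R2)); apply: th'_mono => //.
      by rewrite -ltnS prednK// ltnW.
    by rewrite prednK// ltnW.
  split.
    (* (II): a decision k <= m - 1 has estimate <= f_k <= th''_k <= th''_(m-1) <= t1. *)
    move=> t1 t2 R1 R2 t12; rewrite RejE.
    apply: PE_down => //; [exact: Rset_Theta R1|exact: Rset_Theta R2|].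
    move=> l w Dne; rewrite prednK// => -[Dm D1].
    have Dm' : (1 <= D z l w < m)%N.
      by rewrite lt0n Dne ltn_neqAle Dm andbT; apply/eqP.
    apply: (hat_le z l w _ t1 Dm' erefl); have /andP[D0 Dlt] := Dm'.
    apply: (@le_trans _ _ (th'' m.-1)); last by apply: Rset_ge => //;
      rewrite -ltnS prednK.
    by apply: th''_mono => //; [rewrite im1|rewrite prednK].
  split.
    (* (III): the index lists leave out the entries beta_0 and alpha_m of the two maxima, which
       belong to no test; an empty list costs nothing. *)
    move=> i t; rewrite im1 => im Ri; rewrite RejE.
    apply: (PE_max z _ (fun l => low_set z l i `|` high_set z l i)) => //.
      by move=> l w Dne; exact: Rej_sub.
    move=> l ls; have Tt := Rset_Theta i t Ri.
    have [|ml Pl] := low z l t (betabar i z) (iota 1 i) z0 ls Tt (bmax0 _ _ _).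
      move=> k; rewrite mem_iota add1n ltnS => /andP[k1 ki]; split.
      - by rewrite k1 (leq_ltn_trans ki).
      - apply: (@le_trans _ _ (th'' i)); first exact: th''_mono.
        by apply: Rset_ge => //; exact: leq_trans ki.
      - by apply: (bmax (fun k => beta k z)); rewrite ltnS ki.
    have [|mh Ph] := high z l t (alphabar i z) (index_iota i.+1 m) z0 ls Tt
      (bmax0 _ _ _).
      move=> k; rewrite mem_index_iota => /andP[ik km]; split.
      - by rewrite km (leq_trans _ ik).
      - apply: (@le_trans _ _ (th' i.+1)); last exact: th'_mono.
        by apply: Rset_le => //; exact: leq_ltn_trans km.
      - by apply: (bmax (fun k => alpha k z)); rewrite ik ltnS ltnW.
    split; first exact: measurableU.
    apply: (@le_trans _ _ (P t (low_set z l i) + P t (high_set z l i))%E).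
      exact: measureU2.
    by rewrite addrC EFinD; exact: leeD.
  split.
    move=> i; rewrite im1 => im; have [Ti _ _] := Tth i im;
      have /andP[i1 im'] := im.
    split.
      move=> t Tt ti; rewrite AccE.
      apply: (PE_max z _ (fun l => [set w | exists2 k, k \in [:: i] &
          (gl z l k < (hat z l w)%:E)%E])) => //.
        move=> l w _ Di; exists i; first exact: mem_head.
        by apply: (D_upper z l w i.+1 _ Di); rewrite ltnS.
      move=> l ls; apply: high => //; first exact: ltW (pos i im).1.
      by move=> k; rewrite inE => /eqP ->.
    move=> t1 t2 T1 T2 t12 ti; rewrite AccE; apply: PE_up => //.
    by move=> l w _ Di; apply: (hat_ge z l w i.+1 t2 _ Di).
  move=> i i2; have im : (1 <= i.+1 < m)%N.
    by rewrite /= -im1; move: i2; case: (m) m2 => // -[].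
  have [_ Ti _] := Tth i.+1 im.
  split.
    move=> t Tt ti; rewrite AccE.
    apply: (PE_max z _ (fun l => [set w | exists2 k, k \in [:: i.+1] &
        ((hat z l w)%:E <= fl z l k)%E])) => //.
      move=> l w _ Di; exists i.+1; first exact: mem_head.
      exact: (D_lower z l w i.+1 _ Di).
    move=> l ls; apply: low => //; first exact: ltW (pos i.+1 im).2.
    by move=> k; rewrite inE => /eqP ->.
  move=> t1 t2 T1 T2 ti t12; rewrite AccE; apply: PE_down => //.
  by move=> l w _ Di; apply: (hat_le z l w i.+1 t1 _ Di).
split.
  move=> indep mgf phiE Ephi _ i t; rewrite im1 => im Ri.
  have Tt := Rset_Theta _ _ Ri.
  pose Z n w := n%:R^-1 * \sum_(j < n) Xs j w.
  have phiZ n : (0 < n)%N -> phi_ n = Z n.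
    move=> n0; apply/funext => w; rewrite /phi_ phiE//; congr (_ * _).
    by apply: eq_bigr => j _; rewrite tnth_mktuple.
  (* The first sample takes the place of [X]: unbiasedness for n = 1 gives its mean, and its
     exponential moments come from the common law. *)
  have law0 : identical_samples Theta P (Xs 0%N) Xs.
    by move=> u Tu j A mA; rewrite (same_law u Tu)// (same_law u Tu).
  have mgf0 u rho : Theta u ->
      (P u).-integrable setT (fun w => (expR (rho * Xs 0%N w))%:E).
    move=> Tu; pose g (x : R) := expR (rho * x).
    have mg : measurable_fun setT g.
      by apply: measurableT_comp => //; exact: measurable_funM.
    have g0 x : 0 <= g x by exact: expR_ge0.
    have /integrableP[_ fin] := mgf u rho Tu.
    apply/integrableP; split.
      by apply/measurable_EFinP; exact: (@measurableT_comp _ _ _ _ _ _ g).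
    have nn (Y : T -> R) : (\int[P u]_w `|(expR (Y w))%:E| =
        \int[P u]_w (expR (Y w))%:E)%E.
      by apply: eq_integral => w _; rewrite gee0_abs// lee_fin expR_ge0.
    move: fin; rewrite (nn (fun w => rho * X w)) (nn (fun w => rho * Xs 0%N w)).
    by have := ge0_integral_same_law (same_law u Tu) 0%N mg g0; rewrite /g =>
      ->.
  have mean0 u : Theta u -> (\int[P u]_w (Xs 0%N w)%:E = u%:E)%E.
    move=> Tu; rewrite -(Ephi 1%N u isT Tu) phiZ// unlock.
    by apply: eq_integral => w _; rewrite /Z big_ord1 invr1 mul1r.
  have attZ n : (0 < n)%N -> extrema_attained Theta P (Z n).
    by move=> n0; rewrite -phiZ//; exact: attained.
  (* Errors at the ends of the indifference zones: they dominate those at [t], and the rates are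
     established there. *)
  pose lo k z n := P (th'' k) [set w | ((Z n w)%:E <=
    f_under Theta P (Z n) (th' k) (th'' k) (alpha k z) (beta k z))%E].
  pose hi k z n := P (th' k) [set w |
    (g_over Theta P (Z n) (th' k) (th'' k) (alpha k z) (beta k z) < (Z n
      w)%:E)%E].
  (* Indexing by a finite type, with a guard against k = 0, lets [filter_forall] choose one
     neighbourhood of 0 for all k. *)
  have lo_small (k : 'I_m) e : 0 < e -> \forall z \near 0^'+, (0 < k)%N ->
      (\sum_(1 <= l < (s z).+1) lo k z (ns z l) <= e%:E)%E.
    move=> e0; have [->|k0] := posnP k; first exact: nearW.
    have km : (1 <= k < m)%N by rewrite k0 /=.
    have [T1 T2 t12] := Tth k km.
    have [oa ob] : order_zeta (alpha k) /\ order_zeta (beta k).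
      by apply: ozeta; rewrite im1.
    have a01 z : 0 < z -> 0 < alpha k z < 1.
      by move=> z0; have [] := ab01 k z; rewrite ?im1.
    have b01 z : 0 < z -> 0 < beta k z < 1.
      by move=> z0; have [] := ab01 k z; rewrite ?im1.
    have [n0 [B [M [q [M0 q01 hz]]]]] :=
      lower_error_rate law0 indep mgf0 mean0 attZ T1 T2 t12 oa ob a01 b01.
    have := @sum_stages_small R (fun n z =>
      lo k z n) s ns B M q n0 M0 q01 _ hz hplan e e0.
    by move=> h; have := h (fun n z => measure_ge0 _ _); apply: filterS.
  have hi_small (k : 'I_m) e : 0 < e -> \forall z \near 0^'+, (0 < k)%N ->
      (\sum_(1 <= l < (s z).+1) hi k z (ns z l) <= e%:E)%E.
    move=> e0; have [->|k0] := posnP k; first exact: nearW.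
    have km : (1 <= k < m)%N by rewrite k0 /=.
    have [T1 T2 t12] := Tth k km.
    have [oa ob] : order_zeta (alpha k) /\ order_zeta (beta k).
      by apply: ozeta; rewrite im1.
    have a01 z : 0 < z -> 0 < alpha k z < 1.
      by move=> z0; have [] := ab01 k z; rewrite ?im1.
    have b01 z : 0 < z -> 0 < beta k z < 1.
      by move=> z0; have [] := ab01 k z; rewrite ?im1.
    have [n0 [B [M [q [M0 q01 hz]]]]] :=
      upper_error_rate law0 indep mgf0 mean0 attZ T1 T2 t12 oa ob a01 b01.
    have := @sum_stages_small R (fun n z =>
      hi k z n) s ns B M q n0 M0 q01 _ hz hplan e e0.
    by move=> h; have := h (fun n z => measure_ge0 _ _); apply: filterS.
  have Rej_le z : 0 < z -> (P t (Rej z i) <=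
      \sum_(k <- iota 1 i) \sum_(1 <= l < (s z).+1) lo k z (ns z l) +
      \sum_(k <- index_iota i.+1 m) \sum_(1 <= l < (s z).+1) hi k z (ns z l))%E.
    move=> z0; rewrite RejE.
    have sets l : (1 <= l <= s z)%N ->
        measurable (low_set z l i `|` high_set z l i) /\
        (P t (low_set z l i `|` high_set z l i) <=
         \sum_(k <- iota 1 i) lo k z (ns z l) +
         \sum_(k <- index_iota i.+1 m) hi k z (ns z l))%E.
      move=> ls; have nl0 := Nl0 z l z0 ls.
      have mh := mhat z l z0 ls.
      have [|ml Pl] := @prob_union_le _ _ _ (P t)
        (fun k => [set w | ((hat z l w)%:E <= fl z l k)%E]) (iota 1 i).
        by move=> k _; exact: measurable_lee_set.
      have [|mh' Ph] := @prob_union_le _ _ _ (P t)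
        (fun k => [set w | (gl z l k < (hat z l w)%:E)%E]) (index_iota i.+1 m).
        by move=> k _; exact: measurable_lte_set.
      split; first exact: measurableU.
      apply: (@le_trans _ _ (P t (low_set z l i) + P t (high_set z l i))%E).
        exact: measureU2.
      apply: leeD.
        apply: (le_trans Pl); rewrite big_seq [leRHS]big_seq; apply: lee_sum =>
          k.
        rewrite mem_iota add1n ltnS => /andP[k1 ki].
        have km : (1 <= k < m)%N by rewrite k1 (leq_ltn_trans ki).
        have [_ T2 _] := Tth k km.
        rewrite /lo -(phiZ _ nl0).
        apply: (lower_error_mono lik mphi ule) => //.
        apply: (@le_trans _ _ (th'' i)); first exact: th''_mono.
        by apply: Rset_ge => //; exact: leq_trans ki.
      apply: (le_trans Ph); rewrite big_seq [leRHS]big_seq; apply: lee_sum => k.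
      rewrite mem_index_iota => /andP[ik km].
      have k1 : (1 <= k)%N by exact: leq_trans ik.
      have [T1 _ _] : [/\ Theta (th' k), Theta (th'' k) & th' k < th'' k].
        by apply: Tth; rewrite k1.
      rewrite /hi -(phiZ _ nl0).
      apply: (upper_error_mono lik mphi ule) => //.
      apply: (@le_trans _ _ (th' i.+1)); last exact: th'_mono.
      by apply: Rset_le => //; exact: leq_ltn_trans km.
    apply: (le_trans (PE_sum z _ (fun l =>
      low_set z l i `|` high_set z l i) t z0
      (mRej i.+1) _ _)).
    - by move=> l ls; exact: (sets l ls).1.
    - by move=> l w Dne; exact: Rej_sub.
    (* The sums are exchanged because smallness holds for the sum over stages at fixed k. *)
    rewrite [X in (_ <= X + _)%E]exchange_big [X in (_ <= _ + X)%E]exchange_big.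
    rewrite -big_split /= big_nat [leRHS]big_nat; apply: lee_sum => l;
      rewrite ltnS.
    by move=> ls; exact: (sets l ls).2.
  apply: cvg0_of_le => [z|e e0]; first exact: measure_ge0.
  (* There are i + (m - i - 1) < m sums over stages to share [e]. *)
  have me : 0 < e / m%:R by rewrite divr_gt0// ltr0n.
  near=> z.
  have z0 : 0 < z by near: z; exact: nbhs_right_gt.
  have los : forall k : 'I_m, (0 < k)%N ->
      (\sum_(1 <= l < (s z).+1) lo k z (ns z l) <= (e / m%:R)%:E)%E.
    by near: z; apply: filter_forall => k; exact: lo_small.
  have his : forall k : 'I_m, (0 < k)%N ->
      (\sum_(1 <= l < (s z).+1) hi k z (ns z l) <= (e / m%:R)%:E)%E.
    by near: z; apply: filter_forall => k; exact: hi_small.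
  apply: (le_trans (Rej_le z z0)).
  apply: (@le_trans _ _ (\sum_(k <- iota 1 i) (e / m%:R)%:E +
      \sum_(k <- index_iota i.+1 m) (e / m%:R)%:E)%E).
    apply: leeD.
      rewrite big_seq [leRHS]big_seq; apply: lee_sum => k.
      rewrite mem_iota add1n ltnS => /andP[k1 ki].
      exact: (los (Ordinal (leq_ltn_trans ki im))).
    rewrite big_seq [leRHS]big_seq; apply: lee_sum => k.
    rewrite mem_index_iota => /andP[ik km].
    by apply: (his (Ordinal km)); exact: leq_trans ik.
  rewrite !sumEFin -EFinD lee_fin !big_const_seq !count_predT size_iota
    size_iota.
  rewrite !iter_addr_0 -mulrnDr; apply: (@le_trans _ _ (e / m%:R *+ m)).
    by apply: ler_wpMn2l; [exact: ltW|rewrite -{2}(subnKC im) leq_add2r].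
  by rewrite -mulr_natr divfK// pnatr_eq0 -lt0n.
move=> m3 z z0; have [s0 N1 Ninc] := hplan z z0; have [az bz] := ab0 z z0.
have pos k : (1 <= k < m)%N -> 0 < alpha k z /\ 0 < beta k z.
  move=> km; have [|/andP[? _] /andP[? _]] := ab01 k z _ z0; last by [].
  by rewrite im1.
have mPE C : (forall k, measurable (C k)) -> measurable (PE z C).
  by move=> mC; exact: (measurable_plan_event Xs mphi s0 N1 Ninc (mdec z) mC).
have D2 l w : D z l w != 0%N ->
    (D z l w <= m)%N /\ (D z l w <> 1%N /\ D z l w <> m) ->
    (2 <= D z l w < m)%N.
  move=> Dne [Dm [D1 Dm']]; apply/andP; split.
    by rewrite ltn_neqAle lt0n Dne andbT eq_sym; apply/eqP.
  by rewrite ltn_neqAle Dm andbT; apply/eqP.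
split.
  move=> i t a b /andP[i1 im2] abR /andP[ta tb].
  have im : (i.+1 < m)%N by move: im2 m3; case: (m) => [|[|k]].
  have Ra : Rset i a by apply: abR; rewrite /= in_itv /= lexx (le_trans ta).
  have Rb : Rset i b by apply: abR;
    rewrite /= in_itv /= lexx andbT (le_trans ta).
  have Rt : Rset i t by apply: abR; rewrite /= in_itv /= ta.
  have [Ta Tb Tt] : [/\ Theta a, Theta b & Theta t].
    by split; apply: Rset_Theta; [exact: Ra|exact: Rb|exact: Rt].
  pose Ca k := [set _ : R | (k <= m)%N /\ k <> i.+1] `&` [set x | x <= a].
  pose Cb k := [set _ : R | (k <= m)%N /\ k <> i.+1] `&` [set x | b <= x].
  have mCa k : measurable (Ca k).
    by apply: measurableI => //; exact: measurable_le_set.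
  have mCb k : measurable (Cb k).
    by apply: measurableI => //; exact: measurable_le_set.
  have Ea : Rej z i `&` [set w | thetahat z w <= a] = PE z Ca.
    rewrite RejE; apply/seteqP; split => w; rewrite /setI /= !PEw.
      by move=> [[? ?] ?]; split.
    by move=> [? [? ?]]; split.
  have Eb : Rej z i `&` [set w | b <= thetahat z w] = PE z Cb.
    rewrite RejE; apply/seteqP; split => w; rewrite /setI /= !PEw.
      by move=> [[? ?] ?]; split.
    by move=> [? [? ?]]; split.
  (* Rejection forces the estimate to be at most th''_i <= a or at least th'_(i+1) >= b; each half
     is then monotone in the parameter. *)
  have Rej_ab : Rej z i `<=` PE z Ca `|` PE z Cb.
    move=> w; rewrite RejE PEw => -[Dne DR].
    have [[k]|[k]] := Rej_sub _ _ _ _ (ltnW im) Dne DR.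
      rewrite mem_iota add1n ltnS => /andP[k1 ki] kf.
      left; rewrite PEw; split => //; split => //=.
      rewrite -lee_fin (le_trans kf)// (le_trans (fl_le _ _ _))// lee_fin.
      apply: (@le_trans _ _ (th'' i)); first by apply: th''_mono => //; exact:
        ltnW.
      exact: Rset_ge.
    rewrite mem_index_iota => /andP[ik km] kg.
    right; rewrite PEw; split => //; split => //=.
    rewrite -lee_fin; apply: le_trans (ltW kg); apply: le_trans (gl_ge _ _ _).
    rewrite lee_fin; apply: (@le_trans _ _ (th' i.+1)); last exact: th'_mono.
    exact: Rset_le.
  have mRej_ : measurable (Rej z i) by rewrite RejE; exact: mPE.
  rewrite Ea Eb; split.
    apply: (@le_trans _ _ (P t (PE z Ca) + P t (PE z Cb))%E).
      apply: (@le_trans _ _ (P t (PE z Ca `|` PE z Cb))).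
        by apply: le_prob => //; apply: measurableU; exact: mPE.
      by apply: measureU2; exact: mPE.
    apply: leeD.
      by apply: PE_down => // l w _ [].
    by apply: PE_up => // l w _ [].
  (* For a = b the two halves could share outcomes with estimate a; a < b makes them disjoint, so
     their probabilities add. *)
  move=> ab; apply: (@le_trans _ _ (P t (PE z Ca) + P t (PE z Cb))%E).
    apply: leeD.
      by apply: PE_down => // l w _ [_ /= h]; exact: le_trans ta.
    by apply: PE_up => // l w _ [_ /= h]; exact: le_trans h.
  rewrite -measureU; [|exact: mPE|exact: mPE|].
    apply: le_prob => //; first by apply: measurableU; exact: mPE.
    by move=> w [|]; rewrite -?Ea -?Eb => -[].
  apply/seteqP; split => w //= -[[_ [_ /= ha]] [_ [_ /= hb]]].
  by have := lt_le_trans ab (le_trans hb ha); rewrite ltxx.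
split.
  (* (VIII): only decisions 2 to m - 1 remain, and these bound the estimate on both sides, so the
     arguments for (I) and (II) both apply. *)
  move=> t1 t2 R1 R2 t12; rewrite Rej2E.
  apply: PE_up => //; [exact: Rset_Theta R1|exact: Rset_Theta R2|].
  move=> l w Dne DR; have /andP[Dge Dlt] := D2 l w Dne DR.
  apply: (hat_ge z l w _ t2 Dge erefl).
  apply: (le_trans (Rset_le 0%N t2 m2 R2)); apply: th'_mono => //.
    by rewrite -ltnS prednK// ltnW.
  by rewrite prednK ?(ltnW Dge)// ltnW.
split.
  move=> t1 t2 R1 R2 t12; rewrite Rej2E.
  apply: PE_down => //; [exact: Rset_Theta R1|exact: Rset_Theta R2|].
  move=> l w Dne DR; have /andP[Dge Dlt] := D2 l w Dne DR.
  apply: (hat_le z l w (D z l w) t1 _ erefl); first by rewrite Dlt ltnW.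
  apply: (@le_trans _ _ (th'' m.-1)); last by apply: Rset_ge => //;
    rewrite -ltnS prednK.
  by apply: th''_mono => //; [exact: ltnW|rewrite im1|rewrite prednK].
split.
  move=> t Rt; have Tt := Rset_Theta _ _ Rt; rewrite Rej2E.
  apply: (PE_max z _ (fun l => [set w | exists2 k, k \in index_iota 1 m.-1 &
      (gl z l k < (hat z l w)%:E)%E])) => //.
    move=> l w Dne DR; have /andP[Dge Dlt] := D2 l w Dne DR.
    (* (IX): decision k uses g_(k-1), and k - 1 runs from 1 to m - 2, the range of the maximum of
       the alpha's. *)
    exists (D z l w).-1; last by apply: D_upper.
    rewrite mem_index_iota; apply/andP; split;
      rewrite -ltnS prednK ?(ltnW Dge)//.
    by rewrite prednK.
  move=> l ls; apply: high => // k; rewrite mem_index_iota => /andP[k1 km].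
  have km' : (k < m)%N by rewrite (leq_trans km)// leq_pred.
  split; first by rewrite k1.
  - by apply: (le_trans (Rset_le 0%N t m2 Rt)); exact: th'_mono.
  - by apply: (bmax (fun k => alpha k z)); rewrite k1.
move=> t Rt; have Tt := Rset_Theta _ _ Rt; rewrite Rej2E.
apply: (PE_max z _ (fun l => [set w | exists2 k, k \in index_iota 2 m &
    ((hat z l w)%:E <= fl z l k)%E])) => //.
  move=> l w Dne DR; have /andP[Dge Dlt] := D2 l w Dne DR.
  exists (D z l w); first by rewrite mem_index_iota Dge.
  by apply: D_lower => //; rewrite Dlt ltnW.
move=> l ls; apply: low => // k; rewrite mem_index_iota => /andP[k2 km].
split; first by rewrite km ltnW.
- apply: (@le_trans _ _ (th'' m.-1)); last by apply: Rset_ge => //;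
  rewrite -ltnS prednK.
  by apply: th''_mono => //; [exact: ltnW|rewrite im1|rewrite prednK].
- by apply: (bmax (fun k => beta k z)); rewrite k2.
Unshelve. all: by end_near. Qed.
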